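(* Let $k$ be an infinite $C_1$ field with $\operatorname{char}k\ne 2$, and let $\mathcal{Q}^1\subset\mathcal{T}_{2,2,0}$ be a conic bundle over $\mathbb{P}^1$ of multidegree $(4,4,2,4,2,0)$, with associated sextic surface $X_6\subset\mathbb{P}^3$. If there exists a point $p\in\mathcal{Q}^1$ (defined over $k$) mapping to $p'=\phi(p)\in X_6$ such that $p'\notin\Lambda_2$, the tangent plane $T_{p'}X_6$ contains $\Lambda_2$, and $X_6$ is otherwise general, then $\mathcal{Q}^1$ is unirational over $k$.
   Context: $\mathcal{T}_{2,2,0}=\mathbb{P}(\mathcal{O}_{\mathbb{P}^1}(2)\oplus\mathcal{O}_{\mathbb{P}^1}(2)\oplus\mathcal{O}_{\mathbb{P}^1})$ is the toric variety with Cox ring $k[x_0,x_1,y_0,y_1,y_2]$, $\deg x_i=(1,0)$, $\deg y_0=\deg y_1=(-2,1)$, $\deg y_2=(0,1)$, irrelevant ideal $(x_0,x_1)\cap(y_0,y_1,y_2)$. A conic bundle of multidegree $(4,4,2,4,2,0)$ is $$\mathcal{Q}^1=\{\sigma_{0,0}y_0^2+\sigma_{0,1}y_0y_1+\sigma_{0,2}y_0y_2+\sigma_{1,1}y_1^2+\sigma_{1,2}y_1y_2+\sigma_{2,2}y_2^2=0\}\subset\mathcal{T}_{2,2,0}$$ with $\sigma_{0,0},\sigma_{0,1},\sigma_{1,1}\in k[x_0,x_1]_4$, $\sigma_{0,2},\sigma_{1,2}\in k[x_0,x_1]_2$, $\sigma_{2,2}\in k$, projecting to $\mathbb{P}^1_{[x_0:x_1]}$.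 The (rational) map $\phi:\mathcal{T}_{2,2,0}\dashrightarrow\mathbb{P}^3_{[z_0:z_1:z_2:z_3]}$ is given on the chart $x_1=1$, $y_0=1$ by $[x_0:y_1:y_2:1]$. The closure of the image of $\mathcal{Q}^1$ is a sextic surface $X_6$ with multiplicity $4$ along $\Lambda_4=\{z_0=z_3=0\}$ and multiplicity $2$ along $\Lambda_2=\{z_1=z_3=0\}$. $T_{p'}X_6\subset\mathbb{P}^3$ is the projective tangent plane. ''Otherwise general'' means general among such surfaces subject to the stated tangency condition. A field is $C_1$ if every homogeneous form of degree $d>0$ in more than $d$ variables has a nontrivial zero. *)

(* Defs.v *)
From mathcomp Require Import all_boot all_order all_algebra.
From mathcomp Require Export mpoly.

Set Implicit Arguments.
Unset Strict Implicit.
Unset Printing Implicit Defensive.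

Import GRing.Theory.
Local Open Scope ring_scope.

(* Variables are indexed by ordinals:
     Cox ring of T_{2,2,0} : indices 0, 1, 2, 3, 4 : 'I_5 are x0, x1, y0, y1, y2;
     P^3                   : indices 0, 1, 2, 3 : 'I_4 are z0, z1, z2, z3.
   The numerals are ring numerals of 'I_5 and 'I_4, with the expected values. *)

Definition infinite_field (k : fieldType) : Prop :=
  forall s : seq k, exists x, x \notin s.

Definition C1_field (k : fieldType) : Prop :=
  forall (d n : nat) (F : {mpoly k[n]}), (0 < d < n)%N -> F \is d.-homog ->
  exists2 v : 'I_n -> k, (exists i, v i != 0) & F.@[v] = 0.

Definition mdvd (k : fieldType) (n : nat) (F G : {mpoly k[n]}) : Prop :=
  exists H, G = H * F.

(* ** "General" members of a family of coefficient vectors *)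

Definition zariski_open (k : fieldType) (n : nat) (U : ('I_n -> k) -> Prop) :=
  exists E : {mpoly k[n]} -> Prop,
  forall c, U c <-> exists2 h, E h & h.@[c] != 0.

(* B is contained in the Zariski closure of A *)
Definition zariski_dense_in (k : fieldType) (n : nat)
    (A B : ('I_n -> k) -> Prop) :=
  forall h : {mpoly k[n]},
  (forall c, A c -> h.@[c] = 0) -> forall c, B c -> h.@[c] = 0.

(* P holds on a relatively open dense subset of S *)
Definition holds_for_general (k : fieldType) (n : nat)
    (S P : ('I_n -> k) -> Prop) :=
  exists U : ('I_n -> k) -> Prop,
  [/\ zariski_open U,
      zariski_dense_in (fun c => U c /\ S c) S
    & forall c, U c -> S c -> P c].

(* ** The toric variety T_{2,2,0} *)

Definition cox_bidegree (m : 'X_{1..5}) : int * int :=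
  ((m 0)%:Z + (m 1)%:Z - 2 * ((m 2)%:Z + (m 3)%:Z),
   (m 2)%:Z + (m 3)%:Z + (m 4)%:Z).

Definition bihomogeneous (k : fieldType) (ab : int * int) (G : {mpoly k[5]}) :=
  forall m, m \in msupp G -> cox_bidegree m = ab.

(* p does not lie on the irrelevant locus, i.e. it is a vector of Cox
   coordinates of a k-point of T_{2,2,0}; every k-point has such a vector since
   T_{2,2,0} is smooth and split *)
Definition cox_point (k : fieldType) (p : 'I_5 -> k) : Prop :=
  ~ (p 0 = 0 /\ p 1 = 0) /\ ~ [/\ p 2 = 0, p 3 = 0 & p 4 = 0].

(* ** The conic bundle; c lists the 5 + 5 + 3 + 5 + 3 + 1 = 22 coefficients of
   sigma_{00}, sigma_{01}, sigma_{02}, sigma_{11}, sigma_{12}, sigma_{22} *)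

Definition binary_form (k : fieldType) (d off : nat) (c : 'I_22 -> k) :
    {mpoly k[5]} :=
  \sum_(j < d.+1) c (inord (off + j)) *: ('X_0 ^+ j * 'X_1 ^+ (d - j)).

Definition conic_bundle (k : fieldType) (c : 'I_22 -> k) : {mpoly k[5]} :=
  let s00 := binary_form 4 0 c in
  let s01 := binary_form 4 5 c in
  let s02 := binary_form 2 10 c in
  let s11 := binary_form 4 13 c in
  let s12 := binary_form 2 18 c in
  let s22 := binary_form 0 21 c in
  s00 * 'X_2 ^+ 2 + s01 * 'X_2 * 'X_3 + s02 * 'X_2 * 'X_4
  + s11 * 'X_3 ^+ 2 + s12 * 'X_3 * 'X_4 + s22 * 'X_4 ^+ 2.

(* ** The sextic surface *)

(* phi = [x0 x1 y0 : x1^2 y1 : y2 : x1^2 y0]: all entries have bidegree (0,1),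
   and on the chart x1 = y0 = 1 this is [x0 : y1 : y2 : 1].  The base locus
   x1 = y2 = 0 has codimension 2, so phi is defined exactly off it. *)
Definition phi (k : fieldType) : 4.-tuple {mpoly k[5]} :=
  [tuple 'X_0 * 'X_1 * 'X_2; 'X_1 ^+ 2 * 'X_3; 'X_4; 'X_1 ^+ 2 * 'X_2].

Definition phi_at (k : fieldType) (p : 'I_5 -> k) : 'I_4 -> k :=
  fun i => (tnth (phi k) i).@[p].

(* The (homogeneous) ideal of the closure X_6 of the image of the conic bundle:
   the G whose pullback lies in the ideal of the conic bundle. *)
Definition X6_ideal (k : fieldType) (c : 'I_22 -> k) (G : {mpoly k[4]}) :=
  mdvd (conic_bundle c) (G \mPo phi k).

Definition X6_is_sextic (k : fieldType) (c : 'I_22 -> k) : Prop :=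
  exists F : {mpoly k[4]},
  [/\ F != 0, F \is 6.-homog & forall G, X6_ideal c G <-> mdvd F G].

(* affine cone over the projective tangent space of X_6 at q *)
Definition X6_tangent (k : fieldType) (c : 'I_22 -> k) (q v : 'I_4 -> k) :=
  forall G, X6_ideal c G -> \sum_i (G^`M(i)).@[q] * v i = 0.

Definition is_plane (k : fieldType) (T : ('I_4 -> k) -> Prop) : Prop :=
  exists2 w : 'I_4 -> k, (exists i, w i != 0)
  & forall v, T v <-> \sum_i w i * v i = 0.

Definition on_Lambda2 (k : fieldType) (q : 'I_4 -> k) : Prop :=
  q 1 = 0 /\ q 3 = 0.

(* The surfaces considered: X_6 is a sextic surface, and there is a k-point p of
   the conic bundle, at which phi is defined, whose image is off Lambda_2 and at
   which X_6 has a tangent plane containing Lambda_2. *)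
Definition X6_with_tangency (k : fieldType) (c : 'I_22 -> k) : Prop :=
  X6_is_sextic c /\
  exists p : 'I_5 -> k,
  [/\ cox_point p /\ (conic_bundle c).@[p] = 0,
      exists i, phi_at p i != 0,
      ~ on_Lambda2 (phi_at p),
      is_plane (X6_tangent c (phi_at p))
    & forall v, on_Lambda2 v -> X6_tangent c (phi_at p) v].

(* ** Unirationality: a dominant rational map from P^n over k.
   A rational map from P^n to T_{2,2,0} is given in Cox coordinates by
   forms on P^n of degrees d, d, e, e, e + 2d.  The last clause is dominance:
   every bihomogeneous polynomial vanishing on the image lies in the ideal of
   the conic bundle. *)
Definition unirational (k : fieldType) (c : 'I_22 -> k) : Prop :=
  exists (n d e : nat) (f : 5.-tuple {mpoly k[n.+1]}),
  [/\ [/\ tnth f 0 \is d.-homog, tnth f 1 \is d.-homog, tnth f 2 \is e.-homog,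
          tnth f 3 \is e.-homog & tnth f 4 \is (e + 2 * d).-homog],
      ~ (tnth f 0 = 0 /\ tnth f 1 = 0),
      ~ [/\ tnth f 2 = 0, tnth f 3 = 0 & tnth f 4 = 0],
      conic_bundle c \mPo f = 0
    & forall ab G, bihomogeneous ab G -> G \mPo f = 0 ->
        mdvd (conic_bundle c) G].

(* Main.v *)
Require Import Defs.
From mathcomp Require Import all_boot all_order all_algebra.
From mathcomp Require Import ring zify.
From Stdlib Require Import Classical.

Set Implicit Arguments.
Unset Strict Implicit.
Unset Printing Implicit Defensive.

Import GRing.Theory.
Local Open Scope ring_scope.

(* In the chart x1 = y0 = 1, with t = x0, u = y1, v = y2, completing the square
   in v turns the conic bundle into W^2 = P(t, u) with P quadratic in u and
   quartic in t.  A tangent plane containing Lambda_2 is a plane u = u0, and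
   tangency at a point with t = t0 means that P(t, u0) has a double zero at t0:
   P(t, u0) = (t - t0)^2 a(t).  The section u = u0 is then birational to the
   conic s^2 = a(t), which has a point because k is C_1 and is therefore
   rational when disc a <> 0.  It is a bisection of the conic bundle, and the
   pencil of lines through it in each fibre dominates the conic bundle.

   The condition disc a <> 0 fails only if some P(t, u) is a constant times a
   square, so it is implied by the non-vanishing of the resultant in u of two
   cubic equations of the cone of such quartics.  Given (t0, u0, v0), the
   tangency conditions are linear in the conic bundle, and a segment joining a
   given member to an explicit one with nonzero resultant shows density. *)

(** The existence of [u0] is not an equation in the coefficients, whereas generality must be the
    non-vanishing of a polynomial in the 22 coefficients alone, so [u] has to be eliminated. A
    single equation in [u] has roots over the algebraic closure for almost every member; two
    equations have no common root in general. The locus of surfaces with a tangency is not shown to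
    be irreducible, so one good member does not give density: each given member is joined to a good
    one inside the locus. The explicit member must therefore be adapted to an arbitrary given point,
    in every characteristic other than 2. Dominance is checked on [k]-points, which suffice because
    [k] is infinite. Division by the equation, quadratic in y2, leaves a remainder linear in y2. The
    involution W -> - W separates its two coefficients, and these vanish because the parametrization
    reaches a dense set of values of (x0, x1, y0, y1). *)

(** * Polynomials over an infinite field are determined by their values *)

Lemma uniq_infinite (T : eqType) (P : T -> Prop) (n : nat) :
  (forall s : seq T, exists2 x, P x & x \notin s) ->
  exists s, [/\ size s = n, uniq s & forall x, x \in s -> P x].
Proof.
move=> hP; elim: n => [|n [s [sz us sP]]]; first by exists [::].
have [x Px xs] := hP s.
exists (x :: s); split; rewrite /= ?sz ?xs //.
by move=> y; rewrite inE => /predU1P[->|/sP].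
Qed.

Lemma poly_eq0_infinite (k : fieldType) (q : {poly k}) :
  (forall s : seq k, exists2 x, q.[x] = 0 & x \notin s) -> q = 0.
Proof.
move=> hq; have [s [sz us sq]] := uniq_infinite (size q) hq.
apply/eqP/contraT => q0.
have /(max_poly_roots q0) : all (root q) s by apply/allP => x /sq /rootP.
by rewrite us sz ltnn => /(_ isT).
Qed.

Lemma nonroot (k : fieldType) (k_infinite : infinite_field k) (q : {poly k}) :
  q != 0 -> exists x, q.[x] != 0.
Proof.
move=> q0; apply: NNPP => hq; case/eqP: q0; apply: poly_eq0_infinite => s.
have [x xs] := k_infinite s; exists x => //.
by apply/eqP/contraT => h; case: hq; exists x.
Qed.

Lemma poly_eq0_eval (k : fieldType) (k_infinite : infinite_field k)
    (q : {poly k}) :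
  (forall x, q.[x] = 0) -> q = 0.
Proof.
by move=> hq; apply: poly_eq0_infinite => s; have [x xs] := k_infinite s; exists x.
Qed.

Lemma meval_horner (k : fieldType) n (F : {mpoly k[n]}) (l : 'I_n -> {poly k}) :
  exists q : {poly k}, forall x, q.[x] = F.@[fun j => (l j).[x]].
Proof.
exists (mmap polyC l F) => x; rewrite mevalE /mmap horner_sum.
apply: eq_bigr => m _; rewrite hornerM hornerC /mmap1 horner_prod.
by congr (_ * _); apply: eq_bigr => i _; rewrite horner_exp.
Qed.

(** The induction on the number of variables in [mpoly_eq0_eval] views a polynomial as univariate in
    its last variable. *)
Lemma mpoly_horner_widen (R : comNzRingType) n (F : {mpoly R[n.+1]}) :
  exists G : {poly {mpoly R[n]}}, F = (mpwiden G).['X_ord_max].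
Proof.
elim/mpolyind: F => [|c m F _ _ [G ->]].
  by exists 0; rewrite /mpwiden raddf0 horner0.
exists ((c *: 'X_[[multinom m (widen_ord (leqnSn n) i) | i < n]]) *: 'X^(m ord_max) + G).
rewrite /mpwiden raddfD /= map_polyZ hornerD; congr (_ + _).
rewrite /= map_polyXn hornerZ hornerXn mwidenZ mwidenX -scalerAl; congr (_ *: _).
rewrite (mpolyXE_id R m) (mpolyXE_id R (mnmwiden _))
  [LHS]big_ord_recr [X in _ = X * _]big_ord_recr /=.
rewrite mnmwiden_ordmax expr0 mulr1; congr (_ * _).
apply: eq_bigr => i _; congr (_ ^+ _).
by rewrite (mnmwiden_widen _ i) mnmE.
Qed.

Lemma meval_mwiden (R : comNzRingType) n (F : {mpoly R[n]}) (p : 'I_n.+1 -> R) :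
  (mwiden F).@[p] = F.@[fun i => p (widen_ord (leqnSn n) i)].
Proof.
elim/mpolyind: F => [|c m F _ _ IH]; first by rewrite mwiden0 !meval0.
rewrite mwidenD mwidenZ mwidenX !mevalD !mevalZ !mevalX IH; congr (_ * _ + _).
rewrite big_ord_recr /= mnmwiden_ordmax expr0 mulr1.
apply: eq_bigr => i _; congr (_ ^+ _).
exact: (mnmwiden_widen m).
Qed.

Lemma mpoly_eq0_eval (k : fieldType) (k_infinite : infinite_field k) n
    (F : {mpoly k[n]}) :
  (forall p, F.@[p] = 0) -> F = 0.
Proof.
elim: n F => [|n IH] F hF.
  move: (hF (fun _ => 0)); rewrite mevalE.
  under eq_bigr => m _ do rewrite big_ord0 mulr1.
  move=> h; rewrite [F]mpolyE.
  rewrite (eq_bigr (fun m => F@_m *: 1)).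
    by rewrite -scaler_suml h scale0r.
  move=> m _; congr (_ *: _); rewrite -mpolyX0; congr 'X_[_].
  by apply/mnmP; case.
have [G FG] := mpoly_horner_widen F.
suff G0 : G = 0 by rewrite FG G0 /mpwiden raddf0 horner0.
apply/polyP => j; rewrite coef0; apply: IH => p.
suff h : map_poly (meval p) G = 0 by rewrite -[LHS](coef_map (meval p)) h coef0.
apply: poly_eq0_eval => // x.
pose px (i : 'I_n.+1) := if unlift ord_max i is Some j then p j else x.
rewrite -[RHS](hF px) FG; elim/poly_ind: G {FG} => [|H c IHG].
  by rewrite /mpwiden !raddf0 !horner0 meval0.
rewrite /mpwiden !rmorphD !rmorphM /= !map_polyX !map_polyC !hornerE IHG.
rewrite mevalD mevalM mevalXU meval_mwiden /= /px unlift_none; congr (_ + _).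
apply: meval_eq => i; case: unliftP => [i' /(congr1 val)|/(congr1 val)] /=.
  rewrite /bump leqNgt ltn_ord add0n => ii.
  by congr p; apply/val_inj.
by move=> ii; move: (ltn_ord i); rewrite ii ltnn.
Qed.

(** * The conic bundle in coordinates *)

Definition coef (k : fieldType) (c : 'I_22 -> k) (n : nat) : k := c (inord n).

(** The coefficients form an arbitrary sequence in an arbitrary commutative ring: the same formula
    serves for values, for polynomial arguments, for derivations and for ring morphisms, and its
    identities are left to [ring]. *)
Definition quadric (R : comNzRingType) (e : nat -> R) (o : nat) (x y : R) : R :=
  e o * y ^+ 2 + e o.+1 * x * y + e o.+2 * x ^+ 2.

Definition quartic (R : comNzRingType) (e : nat -> R) (o : nat) (x y : R) : R :=
  e o * y ^+ 4 + e o.+1 * x * y ^+ 3 + e o.+2 * x ^+ 2 * y ^+ 2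
  + e o.+3 * x ^+ 3 * y + e o.+4 * x ^+ 4.

Definition conic (R : comNzRingType) (e : nat -> R) (x0 x1 y0 y1 y2 : R) : R :=
  quartic e 0 x0 x1 * y0 ^+ 2 + quartic e 5 x0 x1 * y0 * y1
  + quadric e 10 x0 x1 * y0 * y2 + quartic e 13 x0 x1 * y1 ^+ 2
  + quadric e 18 x0 x1 * y1 * y2 + e 21%N * y2 ^+ 2.

Lemma comp_mpolyM (R : comNzRingType) n l (f : n.-tuple {mpoly R[l]})
    (F G : {mpoly R[n]}) : (F * G) \mPo f = (F \mPo f) * (G \mPo f).
Proof. exact: rmorphM. Qed.

Lemma comp_mpolyXn (R : comNzRingType) n l (f : n.-tuple {mpoly R[l]})
    (F : {mpoly R[n]}) m : (F ^+ m) \mPo f = (F \mPo f) ^+ m.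
Proof. exact: rmorphXn. Qed.

Lemma mevalXn (R : comNzRingType) n (p : 'I_n -> R) (F : {mpoly R[n]}) m :
  (F ^+ m).@[p] = F.@[p] ^+ m.
Proof. exact: rmorphXn. Qed.

Lemma binary_form_comp (k : fieldType) (c : 'I_22 -> k) d o n
    (f : 5.-tuple {mpoly k[n]}) :
  binary_form d o c \mPo f
  = \sum_(j < d.+1) (coef c (o + j))%:MP * (tnth f 0 ^+ j * tnth f 1 ^+ (d - j)).
Proof.
rewrite /binary_form raddf_sum; apply: eq_bigr => j _.
rewrite /= comp_mpolyZ mul_mpolyC comp_mpolyM !comp_mpolyXn !comp_mpolyXU.
by rewrite !(tnth_nth 0).
Qed.

Lemma binary_form_eval (k : fieldType) (c : 'I_22 -> k) d o (p : 'I_5 -> k) :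
  (binary_form d o c).@[p]
  = \sum_(j < d.+1) coef c (o + j) * (p 0 ^+ j * p 1 ^+ (d - j)).
Proof.
rewrite /binary_form raddf_sum; apply: eq_bigr => j _.
by rewrite /= mevalZ mevalM !mevalXn !mevalXU.
Qed.

Lemma sum_quadric (R : comNzRingType) (e : nat -> R) o (x y : R) :
  \sum_(j < 3) e (o + j)%N * (x ^+ j * y ^+ (2 - j)) = quadric e o x y.
Proof.
rewrite !big_ord_recr big_ord0 /= !addnS !addn0 ?subSS !subn0 /quadric.
ring.
Qed.

Lemma sum_quartic (R : comNzRingType) (e : nat -> R) o (x y : R) :
  \sum_(j < 5) e (o + j)%N * (x ^+ j * y ^+ (4 - j)) = quartic e o x y.
Proof.
rewrite !big_ord_recr big_ord0 /= !addnS !addn0 ?subSS !subn0 /quartic.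
ring.
Qed.

Lemma conic_bundle_comp (k : fieldType) (c : 'I_22 -> k) n
    (f : 5.-tuple {mpoly k[n]}) :
  conic_bundle c \mPo f
  = conic (fun i => (coef c i)%:MP)
      (tnth f 0) (tnth f 1) (tnth f 2) (tnth f 3) (tnth f 4).
Proof.
rewrite /conic_bundle /conic.
rewrite !(comp_mpolyD, comp_mpolyM, comp_mpolyXn) !binary_form_comp !comp_mpolyXU.
rewrite !(sum_quartic (fun i => (coef c i)%:MP)) !(sum_quadric (fun i => (coef c i)%:MP)).
by rewrite big_ord1 addn0 !expr0 !mulr1 !(tnth_nth 0).
Qed.

Lemma conic_bundle_eval (k : fieldType) (c : 'I_22 -> k) (p : 'I_5 -> k) :
  (conic_bundle c).@[p] = conic (coef c) (p 0) (p 1) (p 2) (p 3) (p 4).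
Proof.
rewrite /conic_bundle /conic.
rewrite !(mevalD, mevalM, mevalXn) !binary_form_eval !mevalXU.
by rewrite !sum_quartic !sum_quadric big_ord1 addn0 !expr0 !mulr1.
Qed.

(** * The sextic surface and its ideal *)

Lemma phi_atE (k : fieldType) (p : 'I_5 -> k) :
  [/\ phi_at p 0 = p 0 * p 1 * p 2, phi_at p 1 = p 1 ^+ 2 * p 3,
      phi_at p 2 = p 4 & phi_at p 3 = p 1 ^+ 2 * p 2].
Proof.
by split; rewrite /phi_at /phi (tnth_nth 0) /= ?(mevalM, mevalXn, mevalXU).
Qed.

(* A section of [phi] up to scaling: phi (psi z) = z3 ^ 2 z. *)
Definition psi (k : fieldType) : 5.-tuple {mpoly k[4]} :=
  [tuple 'X_0; 'X_3; 'X_3; 'X_1; 'X_3 ^+ 2 * 'X_2].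

(** Under [psi] the variables x0, x1, y0, y1 get degree 1 and y2 gets degree 3, so each of the six
    terms gets degree 6. *)
Definition sextic (k : fieldType) (c : 'I_22 -> k) : {mpoly k[4]} :=
  conic_bundle c \mPo psi k.

Lemma sexticE (k : fieldType) (c : 'I_22 -> k) :
  sextic c = conic (fun i => (coef c i)%:MP) 'X_0 'X_3 'X_3 'X_1 ('X_3 ^+ 2 * 'X_2).
Proof. by rewrite /sextic conic_bundle_comp !(tnth_nth 0). Qed.

Lemma sextic_eval (k : fieldType) (c : 'I_22 -> k) (z : 'I_4 -> k) :
  (sextic c).@[z] = conic (coef c) (z 0) (z 3) (z 3) (z 1) (z 3 ^+ 2 * z 2).
Proof.
rewrite /sextic comp_mpoly_meval conic_bundle_eval !(tnth_nth 0) /=.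
by rewrite !(mevalM, mevalXn, mevalXU).
Qed.

Lemma dhomogXU (R : nzRingType) n (i : 'I_n) : ('X_i : {mpoly R[n]}) \is 1.-homog.
Proof. by rewrite dhomogX; apply/eqP/mdeg1. Qed.

Lemma dhomog_eq (R : nzRingType) n d e (F : {mpoly R[n]}) :
  F \is d.-homog -> d = e -> F \is e.-homog.
Proof. by move=> hF <-. Qed.

Lemma dhomogCM (R : nzRingType) n d (a : R) (F : {mpoly R[n]}) :
  F \is d.-homog -> a%:MP * F \is d.-homog.
Proof. by move=> hF; rewrite mul_mpolyC rpredZ. Qed.

Lemma dhomog_add (R : nzRingType) n d (F G : {mpoly R[n]}) :
  F \is d.-homog -> G \is d.-homog -> F + G \is d.-homog.
Proof. exact: rpredD. Qed.

Lemma dhomog_opp (R : nzRingType) n d (F : {mpoly R[n]}) :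
  F \is d.-homog -> - F \is d.-homog.
Proof. by rewrite rpredN. Qed.

(* [homog_degree] leaves the degree to unification, [solve_homog] checks it by [lia] *)
Ltac homog_degree :=
  lazymatch goal with
  | |- is_true (in_mem (@GRing.mul _ (@mpolyC _ _ _) _) _) =>
    refine (dhomogCM _ _); homog_degree
  | |- is_true (in_mem (@GRing.mul _ _ _) _) => refine (dhomogM _ _); homog_degree
  | |- is_true (in_mem (@GRing.exp _ _ _) _) => refine (dhomogMn _ _); homog_degree
  | h : is_true (in_mem ?F _) |- is_true (in_mem ?F _) => exact h
  | _ => exact (dhomogXU _ _)
  end.

Ltac solve_homog :=
  lazymatch goal with
  | |- is_true (in_mem (@GRing.add _ _ _) _) => refine (dhomog_add _ _); solve_homog
  | |- is_true (in_mem (@GRing.opp _ _) _) => refine (dhomog_opp _); solve_homog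
  | _ => refine (dhomog_eq _ _); [homog_degree | first [reflexivity | clear; lia]]
  end.

Lemma quadric_dhomog (k : fieldType) (e : nat -> k) o n d
    (x y : {mpoly k[n]}) : x \is d.-homog -> y \is d.-homog ->
  quadric (fun i => (e i)%:MP) o x y \is (2 * d).-homog.
Proof. by move=> hx hy; rewrite /quadric -!mulrA; solve_homog. Qed.

Lemma quartic_dhomog (k : fieldType) (e : nat -> k) o n d
    (x y : {mpoly k[n]}) : x \is d.-homog -> y \is d.-homog ->
  quartic (fun i => (e i)%:MP) o x y \is (4 * d).-homog.
Proof. by move=> hx hy; rewrite /quartic -!mulrA; solve_homog. Qed.

Lemma sextic_dhomog (k : fieldType) (c : 'I_22 -> k) : sextic c \is 6.-homog.
Proof.
have q2 o := quadric_dhomog (coef c) o (dhomogXU _ 0) (dhomogXU k (3 : 'I_4)).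
have q4 o := quartic_dhomog (coef c) o (dhomogXU _ 0) (dhomogXU k (3 : 'I_4)).
rewrite sexticE /conic.
have := q2 10%N; have := q2 18%N; have := q4 0%N; have := q4 5%N; have := q4 13%N.
set A := quartic _ 0 _ _; set B := quartic _ 5 _ _; set C := quadric _ 10 _ _.
set D := quartic _ 13 _ _; set E := quadric _ 18 _ _.
move: A B C D E => A B C D E hD hB hA hE hC.
have hX := dhomogXU k (3 : 'I_4); have hY := dhomogXU k (1 : 'I_4).
have hZ := dhomogXU k (2 : 'I_4).
move: 'X_3 'X_1 'X_2 hX hY hZ => X Y Z hX hY hZ.
by solve_homog.
Qed.

(** [psi] after [phi] is the torus action (l x0, l x1, m y0, m y1, l^2 m y2) with l = x1 y0 and m =
    x1^2, which scales the equation by l^4 m^2. *)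
Lemma sextic_phi (k : fieldType) (k_infinite : infinite_field k) (c : 'I_22 -> k) :
  sextic c \mPo phi k = 'X_1 ^+ 8 * 'X_2 ^+ 4 * conic_bundle c.
Proof.
apply/eqP; rewrite -subr_eq0; apply/eqP/(mpoly_eq0_eval k_infinite) => p.
have [p0 p1 p2 p3] := phi_atE p.
rewrite mevalB !(mevalXn, mevalM) !mevalXU conic_bundle_eval comp_mpoly_meval.
rewrite sextic_eval -!/(phi_at p _) p0 p1 p2 p3 /conic /quartic /quadric.
ring.
Qed.

Lemma meval_dhomog (R : comNzRingType) n d (F : {mpoly R[n]}) (l : R) p :
  F \is d.-homog -> F.@[fun i => l * p i] = l ^+ d * F.@[p].
Proof.
move=> /dhomogP hF; rewrite !mevalE mulr_sumr; apply: eq_big_seq => m mF.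
have -> : d = mdeg m := esym (hF m mF).
rewrite mulrCA; congr (_ * _); rewrite mdegE -prodrXr -big_split /=.
by apply: eq_bigr => i _; rewrite exprMn.
Qed.

Lemma dhomog_msizeE (R : nzRingType) n d (F : {mpoly R[n]}) :
  F \is d.-homog -> F != 0 -> msize F = d.+1.
Proof.
move=> hF F0; rewrite (dhomog_uniq F0 hF (dhomog_msize hF)) prednK //.
by rewrite lt0n msize_poly_eq0.
Qed.

Lemma mpolyX_neq0 (R : nzRingType) n (i : 'I_n) : ('X_i : {mpoly R[n]}) != 0.
Proof. by rewrite -msize_poly_eq0 msizeX. Qed.

Lemma comp_mpoly_sum (R : comNzRingType) n l (f : n.-tuple {mpoly R[l]})
    (I : Type) (r : seq I) (P : pred I) (G : I -> {mpoly R[n]}) :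
  (\sum_(i <- r | P i) G i) \mPo f = \sum_(i <- r | P i) (G i \mPo f).
Proof. exact: raddf_sum. Qed.

Lemma pihomog_sum (R : nzRingType) n d (I : Type) (r : seq I) (P : pred I)
    (G : I -> {mpoly R[n]}) :
  pihomog mdeg d (\sum_(i <- r | P i) G i) = \sum_(i <- r | P i) pihomog mdeg d (G i).
Proof. exact: raddf_sum. Qed.

Lemma mdvd_sum (k : fieldType) n (F : {mpoly k[n]}) (I : Type) (r : seq I)
    (P : pred I) (G : I -> {mpoly k[n]}) :
  (forall i, P i -> mdvd F (G i)) -> mdvd F (\sum_(i <- r | P i) G i).
Proof.
move=> hG; elim/big_rec: _ => [|i _ Pi [H ->]]; first by exists 0; rewrite mul0r.
by have [K ->] := hG i Pi; exists (K + H); rewrite mulrDl.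
Qed.

Lemma mdvd_pihomog (k : fieldType) n d e (F G : {mpoly k[n]}) :
  F \is d.-homog -> mdvd F G -> mdvd F (pihomog mdeg e G).
Proof.
move=> hF [H ->]; rewrite (pihomog_partitionE (leqnn (mmeasure mdeg H))).
rewrite mulr_suml raddf_sum; apply: mdvd_sum => j _.
have hj : pihomog mdeg j H * F \is (j + d).-homog by apply: dhomogM (pihomogP _ _ _) hF.
case: (eqVneq (j + d)%N e) => [<-|ne].
  by exists (pihomog mdeg j H); rewrite /= pihomog_dE.
by exists 0; rewrite /= (pihomog_ne0 ne hj) mul0r.
Qed.

Lemma mpoly_split_var (k : fieldType) n (i : 'I_n) (G : {mpoly k[n]}) :
  exists H G0, G = H * 'X_i + G0 /\
    forall p q : 'I_n -> k, (forall j, j != i -> p j = q j) -> G0.@[p] = G0.@[q].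
Proof.
elim/mpolyind: G => [|c m G _ _ [H [G0 [-> hG0]]]].
  by exists 0, 0; split=> [|p q _]; rewrite ?mul0r ?addr0 ?meval0.
case: (eqVneq (m i) 0%N) => mi.
  exists H, (c *: 'X_[m] + G0); split=> [|p q pq]; first by ring.
  rewrite !mevalD !mevalZ !mevalX (hG0 p q pq); congr (_ * _ + _).
  apply: eq_bigr => j _; case: (eqVneq j i) => [->|ji]; first by rewrite mi.
  by rewrite pq.
exists (c *: 'X_[m - U_(i)] + H), G0; split=> //.
have -> : 'X_[m] = 'X_[m - U_(i)] * 'X_i :> {mpoly k[n]}.
  by rewrite -mpolyXD submK //; apply/mnm_lepP => j; rewrite mnm1E; case: eqVneq => [<-|]; lia.
by rewrite mulrDl scalerAl addrA.
Qed.

Lemma mdvd_var (k : fieldType) (k_infinite : infinite_field k) n (i : 'I_n)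
    (G : {mpoly k[n]}) :
  (forall p, p i = 0 -> G.@[p] = 0) -> exists H, G = H * 'X_i.
Proof.
move=> hG; have [H [G0 [GE hG0]]] := mpoly_split_var i G.
suff G00 : G0 = 0 by exists H; rewrite GE G00 addr0.
apply: (mpoly_eq0_eval k_infinite) => p.
pose p' j := if j == i then 0 else p j.
rewrite (hG0 p p') => [|j /negPf ji]; last by rewrite /p' ji.
have p'i : p' i = 0 by rewrite /p' eqxx.
by have := hG p' p'i; rewrite GE mevalD mevalM mevalXU p'i mulr0 add0r.
Qed.

Section SexticIdeal.
Variables (k : fieldType) (k_infinite : infinite_field k) (c : 'I_22 -> k).

(** On the plane z3 = 0 only the monomial x0^4 y1^2 of the equation survives, so [coef c 17] decides
    whether z3 divides the sextic. *)
Lemma sextic_eval_infinity p : p 3 = 0 ->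
  (sextic c).@[p] = coef c 17 * p 0 ^+ 4 * p 1 ^+ 2.
Proof.
by move=> p3; rewrite sextic_eval p3 /conic /quartic /quadric; ring.
Qed.

Lemma sextic_neq0 : coef c 17 != 0 -> sextic c != 0.
Proof.
move=> D4; apply/eqP => F0; case/eqP: D4.
have := @sextic_eval_infinity (fun i => if (i == 3) then 0 else 1) erefl.
by rewrite F0 meval0 !expr1n !mulr1 => /esym.
Qed.

Lemma sextic_in_ideal : X6_ideal c (sextic c).
Proof. by exists ('X_1 ^+ 8 * 'X_2 ^+ 4); rewrite sextic_phi. Qed.

(** Modulo z3 the sextic is a nonzero multiple of z0^4 z1^2, hence not a zero divisor; if z3 divides
    a multiple of the sextic, it divides the cofactor. *)
Lemma mdvd_sextic_cancel (G : {mpoly k[4]}) n : coef c 17 != 0 ->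
  mdvd (sextic c) (G * 'X_3 ^+ n) -> mdvd (sextic c) G.
Proof.
move=> D4; elim: n => [|n IH]; first by rewrite expr0 mulr1.
rewrite exprSr mulrA => -[H HE]; apply: IH.
suff [K HK] : exists K, H = K * 'X_3.
  exists K; apply: (@mulIf _ ('X_3 : {mpoly k[4]})); last by rewrite HE HK mulrAC.
  exact: mpolyX_neq0.
have [K [H0 [HK hH0]]] := mpoly_split_var 3 H; exists K.
suff H00 : H0 * ('X_0 ^+ 4 * 'X_1 ^+ 2) = 0.
  have X01 : ('X_0 ^+ 4 * 'X_1 ^+ 2 : {mpoly k[4]}) != 0.
    by rewrite mulf_neq0 ?expf_neq0 ?mpolyX_neq0.
  move/eqP: H00; rewrite mulf_eq0 (negPf X01) orbF.
  by move=> /eqP H00; rewrite HK H00 addr0.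
apply: (mpoly_eq0_eval k_infinite) => p.
pose p' (j : 'I_4) := if j == 3 then 0 else p j.
rewrite !(mevalM, mevalXn) !mevalXU (hH0 p p') => [|j /negPf ji]; last by rewrite /p' ji.
have := congr1 (meval p') HE; rewrite !mevalM mevalXU sextic_eval_infinity //.
rewrite HK mevalD mevalM mevalXU [p' 3]/= !mulr0 add0r => /esym/eqP.
rewrite -!mulrA (mulrCA (H0.@[_])) mulf_eq0 (negPf D4) => /eqP //.
Qed.

Lemma comp_phi_psi d (G : {mpoly k[4]}) : G \is d.-homog ->
  (G \mPo phi k) \mPo psi k = G * 'X_3 ^+ (2 * d).
Proof.
move=> hG; apply/eqP; rewrite -subr_eq0; apply/eqP/(mpoly_eq0_eval k_infinite) => p.
rewrite mevalB mevalM mevalXn mevalXU !comp_mpoly_meval.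
rewrite (@meval_eq _ _ _ (fun i => p 3 ^+ 2 * p i)).
  rewrite (meval_dhomog _ _ hG) -exprM; ring.
move=> i; set q := (fun _ => _); have [p0 p1 p2 p3] := phi_atE q.
move: p0 p1 p2 p3; rewrite /q !(tnth_nth 0) /= !(mevalXn, mevalM, mevalXU).
rewrite /phi_at => p0 p1 p2 p3; case: i => [[|[|[|[|//]]]] hi].
- by rewrite (_ : Ordinal hi = 0) ?p0; [ring | apply/val_inj].
- by rewrite (_ : Ordinal hi = 1) ?p1; [ring | apply/val_inj].
- by rewrite (_ : Ordinal hi = 2) ?p2; [ring | apply/val_inj].
- by rewrite (_ : Ordinal hi = 3) ?p3; [ring | apply/val_inj].
Qed.

(** Going through [phi] and [psi] multiplies the component of degree d by z3^(2d), hence moves it to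
    degree 3d. These degrees are distinct, so the sextic divides each component times a power of z3,
    and that power cancels. *)
Lemma mdvd_sextic (G : {mpoly k[4]}) : coef c 17 != 0 ->
  X6_ideal c G -> mdvd (sextic c) G.
Proof.
move=> D4 [H HE].
have hd d := comp_phi_psi (pihomogP mdeg d G).
have dvd : mdvd (sextic c) ((G \mPo phi k) \mPo psi k).
  by exists (H \mPo psi k); rewrite HE comp_mpolyM.
have [N GE] : exists N, G = \sum_(j < N) pihomog mdeg j G.
  by exists (mmeasure mdeg G); apply: pihomog_partitionE.
rewrite GE; apply: mdvd_sum => d _; apply: (@mdvd_sextic_cancel _ (2 * d)) => //.
have := mdvd_pihomog (d + 1 * (2 * d)) (sextic_dhomog c) dvd.
rewrite {1}GE (comp_mpoly_sum (phi k)) (comp_mpoly_sum (psi k)) pihomog_sum.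
rewrite (eq_bigr (fun j : 'I_ _ => if j == d then pihomog mdeg d G * 'X_3 ^+ (2 * d) else 0)).
  by rewrite -big_mkcond (big_pred1 d).
move=> j _; rewrite hd.
have hj : pihomog mdeg j G * 'X_3 ^+ (2 * j) \is (j + 1 * (2 * j)).-homog.
  by apply: dhomogM (pihomogP _ _ _) (dhomogMn _ (dhomogXU _ _)).
case: eqVneq => [<-|jd]; first by rewrite pihomog_dE.
rewrite (pihomog_ne0 _ hj) //; apply: contra jd => /eqP h; apply/eqP/val_inj => /=; lia.
Qed.

Lemma X6_idealE : coef c 17 != 0 -> forall G, X6_ideal c G <-> mdvd (sextic c) G.
Proof.
move=> D4 G; split; first exact: mdvd_sextic.
move=> [H ->]; have [K hK] := sextic_in_ideal.
by exists ((H \mPo phi k) * K); rewrite comp_mpolyM hK mulrA.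
Qed.

(** If [coef c 17] vanishes, the sextic is K z3. The pullback x1^2 y0 of z3 cancels against the
    factor x1^8 y0^4 of [sextic_phi], so K already lies in the ideal; having degree 5, it is not a
    multiple of a generator of degree 6. *)
Lemma X6_is_sexticE : X6_is_sextic c <-> coef c 17 != 0.
Proof.
split=> [[F [F0 hF FE]] | D4]; last first.
  by exists (sextic c); split; [exact: sextic_neq0 | exact: sextic_dhomog | exact: X6_idealE].
apply/eqP => D4.
have [H HE] : mdvd F (sextic c) by apply/FE; exact: sextic_in_ideal.
have [K KE] : exists K, sextic c = K * 'X_3.
  by apply: (mdvd_var k_infinite) => p p3; rewrite sextic_eval_infinity // D4 !mul0r.
have [L LE] : mdvd F K.
  apply/FE; exists ('X_1 ^+ 6 * 'X_2 ^+ 3).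
  apply: (@mulIf _ ('X_1 ^+ 2 * 'X_2 : {mpoly k[5]})).
    by rewrite mulf_neq0 ?expf_neq0 ?mpolyX_neq0.
  transitivity (sextic c \mPo phi k); last by rewrite sextic_phi //; ring.
  by rewrite KE comp_mpolyM comp_mpolyXU (_ : _`_3 = 'X_1 ^+ 2 * 'X_2).
(* If the equation were zero, F would pull back to zero under [phi], which [comp_phi_psi] forbids
   for a nonzero form. *)
case: (eqVneq (sextic c) 0) => [S0 | S0].
  have Q0 : conic_bundle c = 0.
    have := sextic_phi k_infinite c; rewrite S0 comp_mpoly0 => /esym/eqP.
    have X12 : ('X_1 ^+ 8 * 'X_2 ^+ 4 : {mpoly k[5]}) != 0.
      by rewrite mulf_neq0 ?expf_neq0 ?mpolyX_neq0.
    by rewrite mulf_eq0 (negPf X12) => /eqP.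
  have [M ME] : X6_ideal c F by apply/FE; exists 1; rewrite mul1r.
  have /eqP := comp_phi_psi hF.
  by rewrite ME Q0 mulr0 comp_mpoly0 eq_sym mulf_eq0 (negPf F0)
    (negPf (expf_neq0 _ (mpolyX_neq0 _ _))).
have K0 : K != 0 by apply: contra_neq S0 => K0; rewrite KE K0 mul0r.
have L0 : L != 0 by apply: contra_neq K0 => L0; rewrite LE L0 mul0r.
have := congr1 (fun P : {mpoly k[4]} => msize P) KE.
have s0 : (0 < msize L)%N by rewrite lt0n msize_poly_eq0.
rewrite LE !msizeM ?mulf_neq0 ?mpolyX_neq0 // msizeX mdeg1.
rewrite (dhomog_msizeE (sextic_dhomog c) S0) (dhomog_msizeE hF F0).
by move: s0; move: (msize L) => m; lia.
Qed.
End SexticIdeal.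

(** * Tangent planes of the sextic *)

Lemma big_ord4 (V : nmodType) (f : 'I_4 -> V) : \sum_i f i = f 0 + f 1 + f 2 + f 3.
Proof.
rewrite !big_ord_recr big_ord0 /= add0r.
by congr (f _ + f _ + f _ + f _); apply/val_inj.
Qed.

Lemma ord4_cases (P : 'I_4 -> Prop) : P 0 -> P 1 -> P 2 -> P 3 -> forall i, P i.
Proof.
move=> P0 P1 P2 P3 [[|[|[|[|//]]]] hi].
- by have -> : Ordinal hi = 0 by apply/val_inj.
- by have -> : Ordinal hi = 1 by apply/val_inj.
- by have -> : Ordinal hi = 2 by apply/val_inj.
- by have -> : Ordinal hi = 3 by apply/val_inj.
Qed.

Lemma mderivXU (R : comNzRingType) n (i j : 'I_n) :
  ('X_j : {mpoly R[n]})^`M(i) = (j == i)%:R.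
Proof.
rewrite mderivX mnm1E; case: eqVneq => [->|]; last by rewrite scale0r.
rewrite scale1r -mpolyX0; congr 'X_[_].
by apply/mnmP => l; rewrite mnmBE subnn mnm0E.
Qed.

Lemma meval_sum (R : comNzRingType) n (p : 'I_n -> R) (I : Type) (r : seq I)
    (P : pred I) (F : I -> {mpoly R[n]}) :
  (\sum_(i <- r | P i) F i).@[p] = \sum_(i <- r | P i) (F i).@[p].
Proof. exact: raddf_sum. Qed.

Lemma euler (R : comNzRingType) n d (F : {mpoly R[n]}) (p : 'I_n -> R) :
  F \is d.-homog -> \sum_i (F^`M(i)).@[p] * p i = d%:R * F.@[p].
Proof.
move=> /dhomogP hF.
have hm m : \sum_i (('X_[m] : {mpoly R[n]})^`M(i)).@[p] * p i
          = (mdeg m)%:R * ('X_[m] : {mpoly R[n]}).@[p].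
  rewrite mdegE natr_sum mulr_suml; apply: eq_bigr => i _.
  rewrite mderivX mevalZ -mulrA -mevalXU -mevalM -mpolyXD.
  case: (posnP (m i)) => [->|mi]; first by rewrite !mul0r.
  by rewrite submK //; apply/mnm_lepP => j; rewrite mnm1E; case: eqVneq => [<-|].
have FE := mpolyE F; rewrite [in LHS]FE [in RHS]FE {FE}.
rewrite (eq_bigr (fun i => \sum_(m <- msupp F) F@_m *
  ((('X_[m] : {mpoly R[n]})^`M(i)).@[p] * p i))).
  rewrite exchange_big meval_sum mulr_sumr; apply: eq_big_seq => m mF.
  by rewrite -mulr_sumr hm /= mevalZ mulrCA; congr (_%:R * _); apply: hF.
move=> i _; rewrite (raddf_sum (mderiv i)) meval_sum mulr_suml; apply: eq_bigr => m _.
by rewrite /= mderivZ mevalZ mulrA.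
Qed.

Definition quadric_dx (R : comNzRingType) (e : nat -> R) (o : nat) (x y : R) : R :=
  e o.+1 * y + 2%:R * e o.+2 * x.

Definition quartic_dx (R : comNzRingType) (e : nat -> R) (o : nat) (x y : R) : R :=
  e o.+1 * y ^+ 3 + 2%:R * e o.+2 * x * y ^+ 2
  + 3%:R * e o.+3 * x ^+ 2 * y + 4%:R * e o.+4 * x ^+ 3.

Definition quadric_dy (R : comNzRingType) (e : nat -> R) (o : nat) (x y : R) : R :=
  2%:R * e o * y + e o.+1 * x.

Definition quartic_dy (R : comNzRingType) (e : nat -> R) (o : nat) (x y : R) : R :=
  4%:R * e o * y ^+ 3 + 3%:R * e o.+1 * x * y ^+ 2
  + 2%:R * e o.+2 * x ^+ 2 * y + e o.+3 * x ^+ 3.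

(* The differential of [conic e] at [(x0, x1, y0, y1, y2)] along [(a0, a1, b0, b1, b2)]. *)
Definition conic_diff (R : comNzRingType) (e : nat -> R)
    (x0 x1 y0 y1 y2 a0 a1 b0 b1 b2 : R) : R :=
  (quartic_dx e 0 x0 x1 * a0 + quartic_dy e 0 x0 x1 * a1) * y0 ^+ 2
  + quartic e 0 x0 x1 * (2%:R * y0 * b0)
  + (quartic_dx e 5 x0 x1 * a0 + quartic_dy e 5 x0 x1 * a1) * y0 * y1
  + quartic e 5 x0 x1 * (b0 * y1 + y0 * b1)
  + (quadric_dx e 10 x0 x1 * a0 + quadric_dy e 10 x0 x1 * a1) * y0 * y2
  + quadric e 10 x0 x1 * (b0 * y2 + y0 * b2)
  + (quartic_dx e 13 x0 x1 * a0 + quartic_dy e 13 x0 x1 * a1) * y1 ^+ 2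
  + quartic e 13 x0 x1 * (2%:R * y1 * b1)
  + (quadric_dx e 18 x0 x1 * a0 + quadric_dy e 18 x0 x1 * a1) * y1 * y2
  + quadric e 18 x0 x1 * (b1 * y2 + y1 * b2)
  + e 21%N * (2%:R * y2 * b2).

(** The derivation [D] is abstract, so that one chain rule gives all four partial derivatives of the
    sextic. *)
Lemma conic_derivation (R : comNzRingType) (D : R -> R) (e : nat -> R)
    (x0 x1 y0 y1 y2 : R) :
  {morph D : x y / x + y} -> (forall x y, D (x * y) = D x * y + x * D y) ->
  (forall i, D (e i) = 0) ->
  D (conic e x0 x1 y0 y1 y2)
  = conic_diff e x0 x1 y0 y1 y2 (D x0) (D x1) (D y0) (D y1) (D y2).
Proof.
move=> DD DM De; rewrite /conic_diff.
have D2 x : D (x ^+ 2) = 2%:R * x * D x by rewrite expr2 DM; ring.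
have D3 x : D (x ^+ 3) = 3%:R * x ^+ 2 * D x by rewrite exprS DM D2; ring.
have D4 x : D (x ^+ 4) = 4%:R * x ^+ 3 * D x by rewrite exprS DM D3; ring.
have Dq2 o x y : D (quadric e o x y) = quadric_dx e o x y * D x + quadric_dy e o x y * D y.
  rewrite /quadric /quadric_dx /quadric_dy.
  by rewrite !DD !(D2, DM) !De; ring.
have Dq4 o x y : D (quartic e o x y) = quartic_dx e o x y * D x + quartic_dy e o x y * D y.
  rewrite /quartic /quartic_dx /quartic_dy.
  by rewrite !DD !(D4, D3, D2, DM) !De; ring.
by rewrite /conic !DD !(D2, DM) !Dq2 !Dq4 !De; ring.
Qed.

Section RingMorphism.
Variables (R S : comNzRingType) (f : {rmorphism R -> S}).
Variables (e : nat -> R) (e' : nat -> S) (fe : forall i, f (e i) = e' i).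

Lemma rmorph_quadric o x y : f (quadric e o x y) = quadric e' o (f x) (f y).
Proof. by rewrite /quadric !(rmorphD, rmorphM, rmorphXn) !fe. Qed.

Lemma rmorph_quartic o x y : f (quartic e o x y) = quartic e' o (f x) (f y).
Proof. by rewrite /quartic !(rmorphD, rmorphM, rmorphXn) !fe. Qed.

Lemma rmorph_conic_diff (x0 x1 y0 y1 y2 a0 a1 b0 b1 b2 : R) :
  f (conic_diff e x0 x1 y0 y1 y2 a0 a1 b0 b1 b2)
  = conic_diff e' (f x0) (f x1) (f y0) (f y1) (f y2)
      (f a0) (f a1) (f b0) (f b1) (f b2).
Proof.
have f2x o x y : f (quadric_dx e o x y) = quadric_dx e' o (f x) (f y).
  by rewrite /quadric_dx !(rmorphD, rmorphM, rmorph_nat) !fe.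
have f2y o x y : f (quadric_dy e o x y) = quadric_dy e' o (f x) (f y).
  by rewrite /quadric_dy !(rmorphD, rmorphM, rmorph_nat) !fe.
have f4x o x y : f (quartic_dx e o x y) = quartic_dx e' o (f x) (f y).
  by rewrite /quartic_dx !(rmorphD, rmorphM, rmorphXn, rmorph_nat) !fe.
have f4y o x y : f (quartic_dy e o x y) = quartic_dy e' o (f x) (f y).
  by rewrite /quartic_dy !(rmorphD, rmorphM, rmorphXn, rmorph_nat) !fe.
by rewrite /conic_diff !(rmorphD, rmorphM, rmorphXn, rmorph_nat,
  rmorph_quadric, rmorph_quartic, f2x, f2y, f4x, f4y) !fe.
Qed.

End RingMorphism.

Section Tangency.
Variables (k : fieldType) (k_infinite : infinite_field k) (c : 'I_22 -> k).
Notation e := (coef c).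

Definition conic_dt (t u v : k) : k :=
  quartic_dx e 0 t 1 + quartic_dx e 5 t 1 * u + quadric_dx e 10 t 1 * v
  + quartic_dx e 13 t 1 * u ^+ 2 + quadric_dx e 18 t 1 * u * v.

Definition conic_du (t u v : k) : k :=
  quartic e 5 t 1 + 2%:R * quartic e 13 t 1 * u + quadric e 18 t 1 * v.

Definition conic_dv (t u v : k) : k :=
  quadric e 10 t 1 + quadric e 18 t 1 * u + 2%:R * e 21%N * v.

(** Lambda_2 joins the coordinate points of z0 and z2, so a tangent plane contains it when the
    derivatives in t and v vanish; the derivative in u must then be nonzero for the tangent space to
    be a plane. *)
Definition tangency (t u v : k) : Prop :=
  [/\ conic e t 1 1 u v = 0, conic_dt t u v = 0, conic_dv t u v = 0
    & conic_du t u v != 0].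

Lemma sextic_deriv (i : 'I_4) z :
  ((sextic c)^`M(i)).@[z]
  = conic_diff e (z 0) (z 3) (z 3) (z 1) (z 3 ^+ 2 * z 2)
      (0 == i)%:R (3 == i)%:R (3 == i)%:R (1 == i)%:R
      (2%:R * z 3 * z 2 * (3 == i)%:R + z 3 ^+ 2 * (2 == i)%:R).
Proof.
rewrite sexticE (conic_derivation _ _ _ _ _ (mderivD i) (mderivM i)); last first.
  by move=> j; exact: mderivC.
have -> : ('X_3 ^+ 2 * 'X_2 : {mpoly k[4]})^`M(i)
    = (2%:R * 'X_3 * 'X_2) * (3 == i)%:R + 'X_3 ^+ 2 * (2 == i)%:R.
  rewrite expr2 !mderivM !mderivXU; ring.
rewrite !mderivXU (rmorph_conic_diff (f := meval z) (e' := e)) /=; last first.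
  by move=> j; rewrite mevalC.
by rewrite mevalD !(mevalXn, mevalM) !rmorph_nat !mevalXU.
Qed.

(** This excludes the image points at infinity off Lambda_2: they lie on Lambda_4, where the tangent
    space is not a plane. *)
Lemma sextic_deriv_Lambda4 i z : z 0 = 0 -> z 3 = 0 ->
  ((sextic c)^`M(i)).@[z] = 0.
Proof.
move=> z0 z3; rewrite sextic_deriv z0 z3.
rewrite /conic_diff /quartic_dx /quartic_dy /quadric_dx /quadric_dy /quartic /quadric.
ring.
Qed.

Lemma sextic_deriv_affine t u v z3 (z : 'I_4 -> k) :
  z 0 = z3 * t -> z 1 = z3 * u -> z 2 = z3 * v -> z 3 = z3 ->
  [/\ (sextic c).@[z] = z3 ^+ 6 * conic e t 1 1 u v,
      ((sextic c)^`M(0)).@[z] = z3 ^+ 5 * conic_dt t u v,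
      ((sextic c)^`M(1)).@[z] = z3 ^+ 5 * conic_du t u v
    & ((sextic c)^`M(2)).@[z] = z3 ^+ 5 * conic_dv t u v].
Proof.
move=> h0 h1 h2 h3; rewrite !sextic_deriv sextic_eval h0 h1 h2 h3 /=.
rewrite /conic_diff /conic /conic_dt /conic_du /conic_dv.
rewrite /quartic_dx /quadric_dx /quartic /quadric.
split; ring.
Qed.

Lemma X6_tangentE q v : coef c 17 != 0 -> (sextic c).@[q] = 0 ->
  X6_tangent c q v <-> \sum_i ((sextic c)^`M(i)).@[q] * v i = 0.
Proof.
move=> D4 Fq; split=> [T | hv G /(X6_idealE k_infinite D4) [H ->]].
  by apply: T; apply: sextic_in_ideal.
rewrite (eq_bigr (fun i => H.@[q] * (((sextic c)^`M(i)).@[q] * v i))).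
  by rewrite -mulr_sumr hv mulr0.
by move=> i _; rewrite mderivM mevalD !mevalM Fq mulr0 add0r mulrA.
Qed.

Lemma tangency_of_X6 : X6_with_tangency c ->
  coef c 17 != 0 /\ exists t u v, tangency t u v.
Proof.
move=> [/(X6_is_sexticE k_infinite) D4 [p [[_ Qp] _ nL [w [i0 wi0] Tw] TL]]].
split=> //; set q := phi_at p in nL Tw TL.
have [q0 q1 q2 q3] := phi_atE p; rewrite -/q in q0 q1 q2 q3.
have Fq : (sextic c).@[q] = 0.
  have := congr1 (meval p) (sextic_phi k_infinite c).
  by rewrite comp_mpoly_meval [in RHS]mevalM Qp mulr0.
have TE v := X6_tangentE v D4 Fq.
have grad : ~ forall i, ((sextic c)^`M(i)).@[q] = 0.
  move=> h; case/eqP: wi0.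
  have /Tw : X6_tangent c q (fun j => (j == i0)%:R).
    by apply/TE/big1 => i _; rewrite h mul0r.
  rewrite (bigD1 i0) //= eqxx mulr1 big1 ?addr0 // => i /negPf ->.
  by rewrite mulr0.
have [d0 d2] : ((sextic c)^`M(0)).@[q] = 0 /\ ((sextic c)^`M(2)).@[q] = 0.
  split.
    have /TE : X6_tangent c q (fun j => (j == 0)%:R) by apply: TL; split.
    by rewrite big_ord4 /= mulr1 !mulr0 !addr0.
  have /TE : X6_tangent c q (fun j => (j == 2)%:R) by apply: TL; split.
  by rewrite big_ord4 /= mulr1 !mulr0 !add0r addr0.
(* At infinity x1^2 y0 = 0: x1 = 0 puts the point on Lambda_2, and y0 = 0 puts it on Lambda_4. *)
case: (eqVneq (q 3) 0) => [q30|q30].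
  case: grad => i; apply: sextic_deriv_Lambda4 => //.
  move: q30; rewrite q3 q0 => /eqP; rewrite mulf_eq0 => /orP[p1|/eqP ->].
    case: nL; split; first by rewrite q1 (eqP p1) mul0r.
    by rewrite q3 (eqP p1) mul0r.
  by rewrite mulr0.
have mK x : x = q 3 * (x / q 3) by rewrite mulrCA mulfV ?mulr1.
have [E0 E1 E2 E3] := sextic_deriv_affine (mK (q 0)) (mK (q 1)) (mK (q 2)) erefl.
have q3n n : q 3 ^+ n != 0 by rewrite expf_neq0.
exists (q 0 / q 3), (q 1 / q 3), (q 2 / q 3); split.
- by apply: (mulfI (q3n 6%N)); rewrite -E0 Fq mulr0.
- by apply: (mulfI (q3n 5%N)); rewrite -E1 d0 mulr0.
- by apply: (mulfI (q3n 5%N)); rewrite -E3 d2 mulr0.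
apply/eqP => du; rewrite du mulr0 in E2.
case: grad; apply: ord4_cases => //.
(* The sextic vanishes at [q], so Euler's relation gives the last derivative without division by the
   degree, in any characteristic. *)
have := euler q (sextic_dhomog c).
rewrite Fq mulr0 big_ord4 d0 d2 E2 !mul0r !add0r => /eqP.
by rewrite mulf_eq0 (negPf q30) orbF => /eqP.
Qed.

Lemma X6_of_tangency t u v : coef c 17 != 0 -> tangency t u v ->
  X6_with_tangency c.
Proof.
move=> D4 [g0 gt gv gu]; split; first exact/X6_is_sexticE.
pose p (i : 'I_5) := nth 0 [:: t; 1; 1; u; v] i.
exists p; set q := phi_at p.
have [q0 q1 q2 q3] := phi_atE p; rewrite -/q in q0 q1 q2 q3.
have {}q0 : q 0 = 1 * t by rewrite q0 /p /= !mulr1 mul1r.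
have {}q1 : q 1 = 1 * u by rewrite q1 /p /= expr1n.
have {}q2 : q 2 = 1 * v by rewrite q2 mul1r.
have {}q3 : q 3 = 1 by rewrite q3 /p /= expr1n mulr1.
have [E0 E1 E2 E3] := sextic_deriv_affine q0 q1 q2 q3.
rewrite g0 mulr0 in E0; rewrite gt mulr0 in E1; rewrite gv mulr0 in E3.
rewrite expr1n mul1r in E2.
have TE w := X6_tangentE w D4 E0.
split.
- split; last by rewrite conic_bundle_eval.
  by split=> [[_ /eqP]|[/eqP]]; rewrite /p /= oner_eq0.
- by exists 3; rewrite q3 oner_neq0.
- by case=> _ /eqP; rewrite q3 oner_eq0.
- exists (fun i => ((sextic c)^`M(i)).@[q]); last exact: TE.
  by exists 1; rewrite E2.
move=> w [w1 w3]; apply/TE.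
by rewrite big_ord4 E1 E3 w1 w3 !mul0r !mulr0 !addr0.
Qed.

End Tangency.

(** * Cox coordinates, the torus action and division by the equation in y2 *)

Definition point4 (k : fieldType) (x0 x1 y0 y1 : k) (i : 'I_4) : k :=
  nth 0 [:: x0; x1; y0; y1] i.

Definition point5 (k : fieldType) (x0 x1 y0 y1 y2 : k) (i : 'I_5) : k :=
  nth 0 [:: x0; x1; y0; y1; y2] i.

Lemma point4E (k : fieldType) (p : 'I_4 -> k) : p =1 point4 (p 0) (p 1) (p 2) (p 3).
Proof. by apply: ord4_cases. Qed.

Lemma meval_mwiden_point (k : fieldType) (F : {mpoly k[4]}) (x0 x1 y0 y1 y2 : k) :
  (mwiden F).@[point5 x0 x1 y0 y1 y2] = F.@[point4 x0 x1 y0 y1].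
Proof. by rewrite meval_mwiden; apply: meval_eq; apply: ord4_cases. Qed.

Lemma prod_ord5 (R : comNzRingType) (f : 'I_5 -> R) :
  \prod_i f i = f 0 * f 1 * f 2 * f 3 * f 4.
Proof.
rewrite !big_ord_recr big_ord0 /= mul1r.
by congr (f _ * f _ * f _ * f _ * f _); apply/val_inj.
Qed.

Lemma bihomogeneous_scale (k : fieldType) ab (G : {mpoly k[5]})
    (l m x0 x1 y0 y1 y2 : k) : bihomogeneous ab G ->
  G.@[point5 x0 x1 y0 y1 y2] = 0 ->
  G.@[point5 (l * x0) (l * x1) (m * y0) (m * y1) (l ^+ 2 * m * y2)] = 0.
Proof.
move=> hG G0.
(* On every monomial the exponent of [l] is n0 + n1 + 2 n4, which is nonnegative although the first
   degree [ab.1] may be negative. *)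
suff -> : G.@[point5 (l * x0) (l * x1) (m * y0) (m * y1) (l ^+ 2 * m * y2)]
    = l ^+ absz (ab.1 + 2 * ab.2) * m ^+ absz ab.2 * G.@[point5 x0 x1 y0 y1 y2].
  by rewrite G0 mulr0.
rewrite !mevalE mulr_sumr; apply: eq_big_seq => mm /hG.
rewrite /cox_bidegree => <- /=; rewrite !prod_ord5 /point5 /=.
set n0 := mm 0; set n1 := mm 1; set n2 := mm 2; set n3 := mm 3; set n4 := mm 4.
have -> : absz (n0%:Z + n1%:Z - 2 * (n2%:Z + n3%:Z) + 2 * (n2%:Z + n3%:Z + n4%:Z))
   = (n0 + n1 + 2 * n4)%N by lia.
by rewrite !exprMn !exprD; ring.
Qed.

Lemma conic_bundle_split (k : fieldType) (k_infinite : infinite_field k)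
    (c : 'I_22 -> k) : exists U V : {mpoly k[4]},
  conic_bundle c = coef c 21 *: 'X_4 ^+ 2 + mwiden U * 'X_4 + mwiden V.
Proof.
pose e i : {mpoly k[4]} := (coef c i)%:MP.
exists (quadric e 10 'X_0 'X_1 * 'X_2 + quadric e 18 'X_0 'X_1 * 'X_3).
exists (quartic e 0 'X_0 'X_1 * 'X_2 * 'X_2 + quartic e 5 'X_0 'X_1 * 'X_2 * 'X_3
  + quartic e 13 'X_0 'X_1 * 'X_3 * 'X_3).
apply/eqP; rewrite -subr_eq0; apply/eqP/(mpoly_eq0_eval k_infinite) => p.
have pE : p =1 point5 (p 0) (p 1) (p 2) (p 3) (p 4).
  move=> i; rewrite /point5; case: i => [[|[|[|[|[|//]]]]] hi] /=;
  by congr p; apply/val_inj.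
rewrite mevalB conic_bundle_eval !mevalD mevalM mevalZ mevalXn !mevalXU.
rewrite !(meval_eq _ pE) !meval_mwiden_point.
set q := point4 _ _ _ _.
have e2 o : (quadric e o 'X_0 'X_1).@[q] = quadric (coef c) o (p 0) (p 1).
  rewrite (rmorph_quadric (f := meval q) (e' := coef c)) /= ?mevalXU //.
    by move=> i; rewrite mevalC.
have e4 o : (quartic e o 'X_0 'X_1).@[q] = quartic (coef c) o (p 0) (p 1).
  rewrite (rmorph_quartic (f := meval q) (e' := coef c)) /= ?mevalXU //.
    by move=> i; rewrite mevalC.
rewrite !mevalD !mevalM !e2 !e4 !mevalXU /q /point4 /= /conic.
ring.
Qed.

(** The equation is quadratic in y2 with invertible leading coefficient. The polynomials that admit
    a division are closed under sums and under products with constants and variables, hence are all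
    polynomials. *)
Lemma conic_bundle_division (k : fieldType) (k_infinite : infinite_field k)
    (c : 'I_22 -> k) (G : {mpoly k[5]}) : coef c 21 != 0 ->
  exists H (R0 R1 : {mpoly k[4]}),
    G = H * conic_bundle c + mwiden R0 + mwiden R1 * 'X_4.
Proof.
move=> f0; have [U [V QE]] := conic_bundle_split k_infinite c.
pose S G := exists H (R0 R1 : {mpoly k[4]}),
  G = H * conic_bundle c + mwiden R0 + mwiden R1 * 'X_4.
have SC a : S a%:MP.
  by exists 0, a%:MP, 0; rewrite mwidenC mwiden0 !mul0r add0r addr0.
have SD G1 G2 : S G1 -> S G2 -> S (G1 + G2).
  move=> [H [R0 [R1 ->]]] [H' [R0' [R1' ->]]].
  by exists (H + H'), (R0 + R0'), (R1 + R1'); rewrite !mwidenD; ring.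
have SW G1 (W : {mpoly k[4]}) : S G1 -> S (G1 * mwiden W).
  move=> [H [R0 [R1 ->]]].
  by exists (H * mwiden W), (R0 * W), (R1 * W); rewrite !mwidenM; ring.
(* Multiplication by y2 creates R1 y2^2, which is replaced modulo the equation by - R1 (U y2 + V) /
   sigma_22. *)
have S4 G1 : S G1 -> S (G1 * 'X_4).
  move=> [H [R0 [R1 ->]]]; pose a := (coef c 21)^-1.
  exists (H * 'X_4 + a%:MP * mwiden R1), (- (a%:MP * R1 * V)), (R0 - a%:MP * R1 * U).
  rewrite mwidenB mwidenN !mwidenM mwidenC QE.
  have aK : a%:MP * (coef c 21)%:MP = 1 :> {mpoly k[5]} by rewrite -mpolyCM mulVf.
  rewrite -!mul_mpolyC.
  set f := (coef c 21)%:MP in aK *; set b := a%:MP in aK *.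
  have -> : (H * 'X_4 + b * mwiden R1) * (f * 'X_4 ^+ 2 + mwiden U * 'X_4 + mwiden V)
     = H * 'X_4 * (f * 'X_4 ^+ 2 + mwiden U * 'X_4 + mwiden V)
       + (b * f) * (mwiden R1 * 'X_4 ^+ 2)
       + b * mwiden R1 * (mwiden U * 'X_4 + mwiden V) by ring.
  by rewrite aK; ring.
have SX i G1 : S G1 -> S (G1 * 'X_i).
  case: (unliftP ord_max i) => [j ->|->] SG1; last first.
    by rewrite (_ : ord_max = 4) ; [exact: S4 | apply/val_inj].
  rewrite (_ : 'X__ = mwiden 'X_j); first exact: SW.
  rewrite mwidenX (mnmwiden1 j); congr 'X_[U_(_)]; apply/val_inj => /=.
  by rewrite /bump leqNgt ltn_ord.
have Smon m : S 'X_[m].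
  rewrite mpolyXE_id -[X in S X]mul1r; pose T P := forall F, S F -> S (F * P).
  suff: T (\prod_i 'X_i ^+ m i) by apply; rewrite -mpolyC1; exact: SC.
  apply: (big_ind T) => [F|P P' TP TP' F SF|i _ F SF]; first by rewrite mulr1.
    by rewrite mulrA; apply/TP'/TP.
  elim: (m i) => [|n IHn]; first by rewrite expr0 mulr1.
  by rewrite exprSr mulrA; apply: SX.
elim/mpolyind: G => [|a m G _ _ IH]; first by rewrite -mpolyC0; exact: SC.
apply: SD IH; rewrite -mul_mpolyC mulrC -[a%:MP]mwidenC.
exact: SW.
Qed.

(** The product of B, D and the N - y D for y in [s] is a nonzero polynomial. This expresses on
    values that a nonconstant rational function dominates the line. *)
Lemma ratio_avoids (k : fieldType) (k_infinite : infinite_field k)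
    (B N D : {poly k}) (s : seq k) : B != 0 -> D != 0 ->
  (forall y, N - y *: D != 0) ->
  exists l, [/\ B.[l] != 0, D.[l] != 0 & N.[l] / D.[l] \notin s].
Proof.
move=> B0 D0 hN.
have [|l] := nonroot k_infinite (q := B * D * \prod_(y <- s) (N - y *: D)).
  rewrite !mulf_neq0 //; rewrite prodf_seq_neq0; apply/allP => y _; exact: hN.
rewrite !hornerM !mulf_eq0 !negb_or => /andP[/andP[Bl Dl] hl]; exists l; split=> //.
apply: contra hl => sl; rewrite horner_prod; apply/eqP.
rewrite (big_rem _ sl) /= !hornerE divfK // subrr mul0r //.
Qed.

(** * The discriminant of the conic bundle and its double zero *)

Section Discriminant.
Variables (R : comNzRingType) (e : nat -> R) (u : R).

(** [disc0], [disc1] and [disc2] are the Taylor coefficients at [u] of the discriminant P(t, u) of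
    the overview, homogenized in t. *)
Definition disc0 (x0 x1 : R) : R :=
  (quadric e 10 x0 x1 + u * quadric e 18 x0 x1) ^+ 2
  - 4%:R * e 21%N * (quartic e 0 x0 x1 + u * quartic e 5 x0 x1
                     + u ^+ 2 * quartic e 13 x0 x1).

Definition disc1 (x0 x1 : R) : R :=
  2%:R * (quadric e 10 x0 x1 + u * quadric e 18 x0 x1) * quadric e 18 x0 x1
  - 4%:R * e 21%N * (quartic e 5 x0 x1 + 2%:R * u * quartic e 13 x0 x1).

Definition disc2 (x0 x1 : R) : R :=
  quadric e 18 x0 x1 ^+ 2 - 4%:R * e 21%N * quartic e 13 x0 x1.

Lemma conic_complete_square x0 x1 y0 y y2 :
  4%:R * e 21%N * conic e x0 x1 y0 (u * y0 + y) y2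
  = (2%:R * e 21%N * y2 + quadric e 10 x0 x1 * y0
     + quadric e 18 x0 x1 * (u * y0 + y)) ^+ 2
    - (disc0 x0 x1 * y0 ^+ 2 + disc1 x0 x1 * y0 * y + disc2 x0 x1 * y ^+ 2).
Proof. by rewrite /conic /disc0 /disc1 /disc2; ring. Qed.

Lemma disc_scale l x0 x1 :
  [/\ disc0 (l * x0) (l * x1) = l ^+ 4 * disc0 x0 x1,
      disc1 (l * x0) (l * x1) = l ^+ 4 * disc1 x0 x1
    & disc2 (l * x0) (l * x1) = l ^+ 4 * disc2 x0 x1].
Proof.
have q2 o : quadric e o (l * x0) (l * x1) = l ^+ 2 * quadric e o x0 x1.
  by rewrite /quadric; ring.
have q4 o : quartic e o (l * x0) (l * x1) = l ^+ 4 * quartic e o x0 x1.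
  by rewrite /quartic; ring.
by rewrite /disc0 /disc1 /disc2 !q2 !q4; split; ring.
Qed.

Definition disc0_coef (i : nat) : R :=
  let q j := e j + u * e (5 + j)%N + u ^+ 2 * e (13 + j)%N in
  let l j := e (10 + j)%N + u * e (18 + j)%N in
  let f := 4%:R * e 21%N in
  nth 0 [:: l 0%N ^+ 2 - f * q 0%N;
            2%:R * l 0%N * l 1%N - f * q 1%N;
            l 1%N ^+ 2 + 2%:R * l 0%N * l 2%N - f * q 2%N;
            2%:R * l 1%N * l 2%N - f * q 3%N;
            l 2%N ^+ 2 - f * q 4%N] i.

Lemma disc0E x0 x1 : disc0 x0 x1 = quartic disc0_coef 0 x0 x1.
Proof. by rewrite /disc0 /quartic /quadric /disc0_coef /=; ring. Qed.

End Discriminant.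

Section DiscriminantMorphism.
Variables (R S : comNzRingType) (f : {rmorphism R -> S}).
Variables (e : nat -> R) (e' : nat -> S) (fe : forall i, f (e i) = e' i).

Lemma rmorph_disc0 u x0 x1 : f (disc0 e u x0 x1) = disc0 e' (f u) (f x0) (f x1).
Proof.
rewrite /disc0 -!(rmorph_quadric fe) -!(rmorph_quartic fe).
move: (quadric e 10 _ _) (quadric e 18 _ _) => A B.
move: (quartic e 0 _ _) (quartic e 5 _ _) (quartic e 13 _ _) => C D E.
by rewrite !(rmorph_nat, rmorphB, rmorphXn, rmorphD, rmorphM) fe.
Qed.

Lemma rmorph_disc1 u x0 x1 : f (disc1 e u x0 x1) = disc1 e' (f u) (f x0) (f x1).
Proof.
rewrite /disc1 -!(rmorph_quadric fe) -!(rmorph_quartic fe).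
move: (quadric e 10 _ _) (quadric e 18 _ _) => A B.
move: (quartic e 5 _ _) (quartic e 13 _ _) => D E.
by rewrite !(rmorph_nat, rmorphB, rmorphXn, rmorphD, rmorphM) fe.
Qed.

Lemma rmorph_disc2 x0 x1 : f (disc2 e x0 x1) = disc2 e' (f x0) (f x1).
Proof.
rewrite /disc2 -!(rmorph_quadric fe) -!(rmorph_quartic fe).
move: (quadric e 18 _ _) (quartic e 13 _ _) => B E.
by rewrite !(rmorph_nat, rmorphB, rmorphXn, rmorphD, rmorphM) fe.
Qed.

End DiscriminantMorphism.

(** P is the square of the derivative in v minus 4 sigma_22 times the equation. Where the equation
    and that derivative vanish, P vanishes and its first derivatives are - 4 sigma_22 times those of
    the equation. *)
Lemma tangency_disc (k : fieldType) (c : 'I_22 -> k) (t u v : k) :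
  (2%:R : k) != 0 -> coef c 21 != 0 -> tangency c t u v ->
  [/\ quartic (disc0_coef (coef c) u) 0 t 1 = 0,
      quartic_dx (disc0_coef (coef c) u) 0 t 1 = 0
    & disc1 (coef c) u t 1 != 0].
Proof.
move=> char2 f0 [g0 gt gv gu].
have E0 : quartic (disc0_coef (coef c) u) 0 t 1
    = conic_dv c t u v ^+ 2 - 4%:R * coef c 21 * conic (coef c) t 1 1 u v.
  by rewrite -disc0E /conic_dv /conic /disc0; ring.
have E1 : quartic_dx (disc0_coef (coef c) u) 0 t 1
    = 2%:R * conic_dv c t u v * (quadric_dx (coef c) 10 t 1 + u * quadric_dx (coef c) 18 t 1)
      - 4%:R * coef c 21 * conic_dt c t u v.
  rewrite /disc0_coef /quartic_dx /conic_dv /conic_dt /quartic_dx /quadric_dx /quadric /=.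
  ring.
have E2 : disc1 (coef c) u t 1
    = 2%:R * conic_dv c t u v * quadric (coef c) 18 t 1
      - 4%:R * coef c 21 * conic_du c t u v.
  by rewrite /disc1 /conic_dv /conic_du; ring.
split; rewrite ?E0 ?E1 ?E2 ?g0 ?gt ?gv ?(expr0n, mulr0, mul0r, subrr) //.
rewrite sub0r oppr_eq0 !mulf_neq0 //.
by rewrite (_ : 4%:R = 2%:R * 2%:R :> k) ?mulf_neq0 //; ring.
Qed.

(* The cofactor of (x0 - t x1) ^ 2 in a quartic with a double zero at [t]. *)
Section DoubleRoot.
Variables (R : comNzRingType) (a : nat -> R) (t : R).

Definition residual (i : nat) : R :=
  let r0 := a 4%N in
  let r1 := a 3%N + 2%:R * t * r0 in
  nth 0 [:: a 2%N + 2%:R * t * r1 - t ^+ 2 * r0; r1; r0] i.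

Hypotheses (a0 : quartic a 0 t 1 = 0) (a1 : quartic_dx a 0 t 1 = 0).

Lemma double_root_coef :
  a 1%N = t ^+ 2 * residual 1 - 2%:R * t * residual 0 /\
  a 0%N = t ^+ 2 * residual 0.
Proof.
have e1 : a 1%N = t ^+ 2 * residual 1 - 2%:R * t * residual 0.
  by apply/eqP; rewrite -subr_eq0 -[X in _ == X]a1 /quartic_dx /residual /=; apply/eqP; ring.
split=> //; apply/eqP; rewrite -subr_eq0 -[X in _ == X]a0 /quartic e1 /residual /=.
by apply/eqP; ring.
Qed.

Lemma quartic_double_root x0 x1 :
  quartic a 0 x0 x1 = (x0 - t * x1) ^+ 2 * quadric residual 0 x0 x1.
Proof.
have [e1 e0] := double_root_coef.
by rewrite /quartic /quadric e0 e1 /residual /=; ring.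
Qed.

End DoubleRoot.

(** * Parametrization of the bisection and of the fibres *)

(* A quadratic form takes the values [s ^ 2] at [xi] and [q] at [eta], and has
   polar value [r] at [(xi, eta)].  The lines through the point [(s, xi)]
   parametrize the conic on which the form is the square of [par_s]; the lines
   [W = par_w * y0 + l * y] in a fibre then give [(par_y0, par_y, par_W)]. *)
Section Parametrization.
Variables (k : fieldType) (c : 'I_22 -> k) (t u xi0 xi1 eta0 eta1 s q r g : k).
Notation e := (coef c).

Section Generic.
Variables (R : comNzRingType) (iota : k -> R) (x y l : R).

(** The point of the conic lies over [par_a] xi + [par_b] eta, and x / y is the slope ([par_s] - s
    [par_a]) / [par_b] of the line through (s, xi). The formulas are used in [k], [{poly k}] and
    [{mpoly k[3]}], with [iota] the inclusion of constants; scalars stand in front of their terms,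
    as [solve_homog] expects. *)
Definition par_a : R := iota q * y ^+ 2 - x ^+ 2.
Definition par_b : R := iota (2%:R * s) * (x * y) - iota r * y ^+ 2.
Definition par_x0 : R := iota xi0 * par_a + iota eta0 * par_b.
Definition par_x1 : R := iota xi1 * par_a + iota eta1 * par_b.
Definition par_s : R := iota s * x ^+ 2 - iota r * (x * y) + iota (s * q) * y ^+ 2.
Definition par_lin : R := par_x0 - iota t * par_x1.
Definition par_w : R := par_lin * par_s.
Definition par_quadric o : R := quadric (fun i => iota (e i)) o par_x0 par_x1.
Definition par_quartic o : R := quartic (fun i => iota (e i)) o par_x0 par_x1.
Definition par_disc1 : R :=
  iota 2%:R * (par_quadric 10 * par_quadric 18)
  + iota (2%:R * u) * par_quadric 18 ^+ 2
  - (iota (4%:R * e 21%N) * par_quartic 5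
     + iota (4%:R * e 21%N * (2%:R * u)) * par_quartic 13).
Definition par_disc2 : R :=
  par_quadric 18 ^+ 2 - iota (4%:R * e 21%N) * par_quartic 13.
(** Substituting the line in the fibre W^2 = w^2 y0^2 + disc1 y0 y + disc2 y^2 cancels y0^2 and then
    a factor y, which leaves (2 w l - disc1) y0 = (disc2 - l^2) y. *)
Definition par_y0 : R := par_disc2 - l ^+ 2.
Definition par_y : R := iota 2%:R * (par_w * l) - par_disc1.
Definition par_y1 : R := iota u * par_y0 + par_y.
Definition par_W : R := par_w * par_disc2 + par_w * l ^+ 2 - par_disc1 * l.
Definition par_y2 : R :=
  iota g * par_W - (iota g * (par_quadric 10 * par_y0) + iota g * (par_quadric 18 * par_y1)).

End Generic.

Section Evaluation.
Variables (R : comNzRingType) (iota : k -> R) (h : {rmorphism R -> k}).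
Hypothesis (h_iota : forall a, h (iota a) = a).
Variables (x y l : R).

Lemma par_x0_eval : h (par_x0 iota x y) = par_x0 id (h x) (h y).
Proof. by rewrite /par_x0 /par_a /par_b !(rmorphB, rmorphD, rmorphXn, rmorphM) !h_iota. Qed.

Lemma par_x1_eval : h (par_x1 iota x y) = par_x1 id (h x) (h y).
Proof. by rewrite /par_x1 /par_a /par_b !(rmorphB, rmorphD, rmorphXn, rmorphM) !h_iota. Qed.

Lemma par_s_eval : h (par_s iota x y) = par_s id (h x) (h y).
Proof. by rewrite /par_s !(rmorphB, rmorphD, rmorphXn, rmorphM) !h_iota. Qed.

Lemma par_w_eval : h (par_w iota x y) = par_w id (h x) (h y).
Proof.
by rewrite /par_w /par_lin rmorphM rmorphB rmorphM par_x0_eval par_x1_eval par_s_eval !h_iota.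
Qed.

Lemma par_quadric_eval o : h (par_quadric iota x y o) = par_quadric id (h x) (h y) o.
Proof.
by rewrite /par_quadric (rmorph_quadric (e' := e)) ?par_x0_eval ?par_x1_eval //.
Qed.

Lemma par_quartic_eval o : h (par_quartic iota x y o) = par_quartic id (h x) (h y) o.
Proof.
by rewrite /par_quartic (rmorph_quartic (e' := e)) ?par_x0_eval ?par_x1_eval //.
Qed.

Lemma par_disc1_eval : h (par_disc1 iota x y) = par_disc1 id (h x) (h y).
Proof.
rewrite /par_disc1 -!par_quadric_eval -!par_quartic_eval.
move: (par_quadric iota x y 10) (par_quadric iota x y 18) => a b.
move: (par_quartic iota x y 5) (par_quartic iota x y 13) => b' d.
by rewrite !(rmorphB, rmorphD, rmorphXn, rmorphM) !h_iota.
Qed.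

Lemma par_disc2_eval : h (par_disc2 iota x y) = par_disc2 id (h x) (h y).
Proof.
rewrite /par_disc2 -!par_quadric_eval -!par_quartic_eval.
move: (par_quadric iota x y 18) (par_quartic iota x y 13) => a b.
by rewrite !(rmorphB, rmorphXn, rmorphM) !h_iota.
Qed.

Lemma par_y0_eval : h (par_y0 iota x y l) = par_y0 id (h x) (h y) (h l).
Proof. by rewrite /par_y0 rmorphB rmorphXn par_disc2_eval. Qed.

Lemma par_y_eval : h (par_y iota x y l) = par_y id (h x) (h y) (h l).
Proof.
rewrite /par_y -par_w_eval -par_disc1_eval.
move: (par_w iota x y) (par_disc1 iota x y) => w d.
by rewrite rmorphB !rmorphM h_iota.
Qed.

Lemma par_y1_eval : h (par_y1 iota x y l) = par_y1 id (h x) (h y) (h l).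
Proof. by rewrite /par_y1 rmorphD rmorphM h_iota par_y0_eval par_y_eval. Qed.

Lemma par_W_eval : h (par_W iota x y l) = par_W id (h x) (h y) (h l).
Proof.
rewrite /par_W -par_w_eval -par_disc1_eval -par_disc2_eval.
move: (par_w iota x y) (par_disc1 iota x y) (par_disc2 iota x y) => w b d.
by rewrite rmorphB rmorphD !(rmorphXn, rmorphM).
Qed.

Lemma par_y2_eval : h (par_y2 iota x y l) = par_y2 id (h x) (h y) (h l).
Proof.
rewrite /par_y2 -par_W_eval -par_y0_eval -par_y1_eval -!par_quadric_eval.
move: (par_W iota x y l) (par_y0 iota x y l) (par_y1 iota x y l) => W y0 y1.
move: (par_quadric iota x y 10) (par_quadric iota x y 18) => a b.
by rewrite rmorphB rmorphD !rmorphM h_iota.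
Qed.

End Evaluation.

Section Homogeneity.
Variables (n : nat) (x y l : {mpoly k[n]}).
Hypotheses (hx : x \is 1.-homog) (hy : y \is 1.-homog) (hl : l \is 4.-homog).
Let iota (a : k) : {mpoly k[n]} := a%:MP.

Lemma par_x_dhomog : par_x0 iota x y \is 2.-homog /\ par_x1 iota x y \is 2.-homog.
Proof.
have ha : par_a iota x y \is 2.-homog by rewrite /par_a /iota; solve_homog.
have hb : par_b iota x y \is 2.-homog by rewrite /par_b /iota; solve_homog.
rewrite /par_x0 /par_x1; move: (par_a _ _ _) (par_b _ _ _) ha hb => a b ha hb.
by split; rewrite /iota; solve_homog.
Qed.

Lemma par_w_dhomog : par_w iota x y \is 4.-homog.
Proof.
have [hx0 hx1] := par_x_dhomog.
have hs : par_s iota x y \is 2.-homog by rewrite /par_s /iota; solve_homog.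
have ht : par_lin iota x y \is 2.-homog.
  rewrite /par_lin; move: (par_x0 _ _ _) (par_x1 _ _ _) hx0 hx1 => a b ha hb.
  by rewrite /iota; solve_homog.
by rewrite /par_w; apply: (dhomogM ht hs).
Qed.

Let hq2 o : par_quadric iota x y o \is 4.-homog.
Proof. by have [hx0 hx1] := par_x_dhomog; apply: (quadric_dhomog e o hx0 hx1). Qed.

Let hq4 o : par_quartic iota x y o \is 8.-homog.
Proof. by have [hx0 hx1] := par_x_dhomog; apply: (quartic_dhomog e o hx0 hx1). Qed.

Lemma par_disc_dhomog :
  par_disc1 iota x y \is 8.-homog /\ par_disc2 iota x y \is 8.-homog.
Proof.
rewrite /par_disc1 /par_disc2; move: (hq2 10) (hq2 18) (hq4 5) (hq4 13).
move: (par_quadric _ _ _ 10) (par_quadric _ _ _ 18) (par_quartic _ _ _ 5)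
  (par_quartic _ _ _ 13) => a b b' d ha hb hb' hd.
by split; rewrite /iota; solve_homog.
Qed.

Lemma par_y_dhomog : [/\ par_y0 iota x y l \is 8.-homog,
  par_y1 iota x y l \is 8.-homog & par_y2 iota x y l \is (8 + 2 * 2).-homog].
Proof.
have [h1 h2] := par_disc_dhomog; have hw := par_w_dhomog.
have h0 : par_y0 iota x y l \is 8.-homog.
  by rewrite /par_y0; move: (par_disc2 _ _ _) h2 => d hd; solve_homog.
have hy' : par_y iota x y l \is 8.-homog.
  rewrite /par_y; move: (par_w _ _ _) (par_disc1 _ _ _) hw h1 => w d h hd.
  by rewrite /iota; solve_homog.
have hy1 : par_y1 iota x y l \is 8.-homog.
  rewrite /par_y1; move: (par_y0 _ _ _ _) (par_y _ _ _ _) h0 hy' => a b ha hb.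
  by rewrite /iota; solve_homog.
split=> //; rewrite /par_y2.
have hW : par_W iota x y l \is 12.-homog.
  rewrite /par_W; move: (par_w _ _ _) (par_disc1 _ _ _) (par_disc2 _ _ _) hw h1 h2 => w d d' h hd hd'.
  by solve_homog.
move: (hq2 10) (hq2 18) hW h0 hy1.
move: (par_W _ _ _ _) (par_quadric _ _ _ 10) (par_quadric _ _ _ 18) (par_y0 _ _ _ _)
  (par_y1 _ _ _ _) => a b b' d d' h1' h2' h3' h4' h5'.
by rewrite /iota; solve_homog.
Qed.

End Homogeneity.

Variable (a : nat -> k).
Hypotheses (char2 : (2%:R : k) != 0) (f0 : e 21%N != 0) (gE : g = (2%:R * e 21%N)^-1).
Hypotheses (disc0_a : forall x0 x1,
  disc0 e u x0 x1 = (x0 - t * x1) ^+ 2 * quadric a 0 x0 x1).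
Hypotheses (a_xi : quadric a 0 xi0 xi1 = s ^+ 2) (a_eta : quadric a 0 eta0 eta1 = q).
Hypothesis (a_polar : 2%:R * a 2%N * xi0 * eta0 + a 1%N * (xi0 * eta1 + xi1 * eta0)
                      + 2%:R * a 0%N * xi1 * eta1 = r).

Notation X0 := (par_x0 id).
Notation X1 := (par_x1 id).

Lemma par_disc0E x y : disc0 e u (X0 x y) (X1 x y) = par_w id x y ^+ 2.
Proof.
rewrite disc0_a /par_w exprMn; congr (_ * _).
transitivity (par_a id x y ^+ 2 * s ^+ 2 + par_a id x y * par_b id x y * r
              + par_b id x y ^+ 2 * q).
  by rewrite -a_xi -a_eta -a_polar /quadric /par_x0 /par_x1; ring.
by rewrite /par_s /par_a /par_b; ring.
Qed.

Lemma par_disc1E x y : disc1 e u (X0 x y) (X1 x y) = par_disc1 id x y.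
Proof. by rewrite /disc1 /par_disc1 /par_quadric /par_quartic; ring. Qed.

Lemma par_disc2E x y : disc2 e (X0 x y) (X1 x y) = par_disc2 id x y.
Proof. by rewrite /disc2 /par_disc2 /par_quadric /par_quartic. Qed.

Lemma par_complete_square x y l :
  2%:R * e 21%N * par_y2 id x y l + quadric e 10 (X0 x y) (X1 x y) * par_y0 id x y l
  + quadric e 18 (X0 x y) (X1 x y) * par_y1 id x y l = par_W id x y l.
Proof.
have gK : 2%:R * e 21%N * g = 1 by rewrite gE mulfV // mulf_neq0.
rewrite /par_y2 -!/(quadric e _ (X0 x y) (X1 x y)) -!/(par_quadric _ _ _ _).
move: (par_quadric id x y 10) (par_quadric id x y 18) => A B.
move: (par_W id x y l) (par_y0 id x y l) (par_y1 id x y l) => W y0 y1.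
transitivity (2%:R * e 21%N * g * (W - A * y0 - B * y1) + A * y0 + B * y1).
  by ring.
by rewrite gK; ring.
Qed.

Lemma par_on_conic x y l :
  conic e (X0 x y) (X1 x y) (par_y0 id x y l) (par_y1 id x y l) (par_y2 id x y l) = 0.
Proof.
have f4 : 4%:R * e 21%N != 0.
  by rewrite mulf_neq0 // (_ : 4%:R = 2%:R * 2%:R) ?mulf_neq0 //; ring.
apply: (mulfI f4); rewrite mulr0 /par_y1 conic_complete_square -/(par_y1 _ _ _ _).
rewrite par_complete_square par_disc0E par_disc1E par_disc2E.
by rewrite /par_W /par_y /par_y0; ring.
Qed.

(* [l] is the slope of the line joining the point of the bisection to [(Y0, Y, W)]. *)
Lemma par_surjective x y Y0 Y W :
  par_disc1 id x y ^+ 2 - 4%:R * par_w id x y ^+ 2 * par_disc2 id x y != 0 ->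
  Y != 0 ->
  W ^+ 2 = par_w id x y ^+ 2 * Y0 ^+ 2 + par_disc1 id x y * Y0 * Y + par_disc2 id x y * Y ^+ 2 ->
  exists m l, [/\ Y0 = m * par_y0 id x y l, Y = m * par_y id x y l
                & W = m * par_W id x y l].
Proof.
rewrite /par_W /par_y /par_y0 /=.
move: (par_w _ _ _) (par_disc1 _ _ _) (par_disc2 _ _ _) => w b d hd Yn0 hW.
pose l := (W - w * Y0) / Y; have lE : W = l * Y + w * Y0 by rewrite divfK // subrK.
have H : (2%:R * (w * l) - b) * Y0 = (d - l ^+ 2) * Y.
  apply: (mulIf Yn0); apply/eqP; rewrite -subr_eq0; apply/eqP.
  transitivity (W ^+ 2 - (w ^+ 2 * Y0 ^+ 2 + b * Y0 * Y + d * Y ^+ 2)).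
    by rewrite lE; ring.
  by rewrite hW subrr.
have n0 : 2%:R * (w * l) - b != 0.
  apply: contra hd => /eqP n0; move: H; rewrite n0 mul0r => /esym/eqP.
  rewrite mulf_eq0 (negPf Yn0) orbF subr_eq0 => /eqP ->.
  by move/eqP: n0; rewrite subr_eq0 => /eqP <-; apply/eqP; ring.
exists (Y / (2%:R * (w * l) - b)), l.
have YE : Y = Y / (2%:R * (w * l) - b) * (2%:R * (w * l) - b) by rewrite divfK.
have Y0E : Y0 = Y / (2%:R * (w * l) - b) * (d - l ^+ 2).
  by rewrite mulrAC; apply: (mulfI n0); rewrite H [RHS]mulrC divfK // mulrC.
set m := Y / _ in YE Y0E *; split=> //.
transitivity (l * (m * (2%:R * (w * l) - b)) + w * (m * (d - l ^+ 2))).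
  by rewrite -YE -Y0E.
by ring.
Qed.


(** * Dominance of the parametrization *)

Hypotheses (k_infinite : infinite_field k) (sr : (s != 0) || (r != 0)).
Hypotheses (xi_eta : xi0 * eta1 - xi1 * eta0 != 0) (disc1_t : disc1 e u t 1 != 0).

Lemma quadratic_poly_eq0 (a2 a1 a0 : k) :
  a2 *: 'X^2 + a1 *: 'X + a0%:P = 0 -> [/\ a2 = 0, a1 = 0 & a0 = 0].
Proof.
move=> h; have hc i : (a2 *: 'X^2 + a1 *: 'X + a0%:P)`_i = 0 by rewrite h coef0.
have := hc 2%N; have := hc 1%N; have := hc 0%N.
by rewrite !coefD !coefZ !coefXn !coefX !coefC /= !mulr0 !mulr1 !addr0 !add0r.
Qed.

(** [par_a] and [par_b] are linearly independent because s and r are not both zero; this makes x0 /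
    x1 nonconstant on the bisection. *)
Lemma par_comb_neq0 z w : (z != 0) || (w != 0) ->
  z%:P * par_a polyC 'X 1 + w%:P * par_b polyC 'X 1 != 0.
Proof.
move=> zw; apply/eqP => h.
have [] := @quadratic_poly_eq0 (- z) (w * (2%:R * s)) (z * q - w * r).
  rewrite -[RHS]h /par_a /par_b -!mul_polyC !(polyCB, polyCN, polyCM); ring.
move=> /eqP; rewrite oppr_eq0 => /eqP z0 /eqP; rewrite z0 mul0r sub0r.
rewrite z0 eqxx /= in zw.
rewrite !mulf_eq0 (negPf zw) (negPf char2) /= => s0 /eqP.
by rewrite oppr_eq0 mulf_eq0 (negPf zw) /= => r0; move: sr; rewrite s0 r0.
Qed.

Lemma par_horner (x : k) :
  [/\ (par_x0 polyC 'X 1).[x] = X0 x 1, (par_x1 polyC 'X 1).[x] = X1 x 1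
    & (par_w polyC 'X 1).[x] = par_w id x 1].
Proof.
pose h : {rmorphism {poly k} -> k} := horner_eval x.
have hC a' : h a'%:P = a' by rewrite /h /= /horner_eval hornerC.
have hX : h 'X = x by rewrite /h /= /horner_eval hornerX.
have h1 : h 1 = 1 by rewrite rmorph1.
have h0 := par_x0_eval hC 'X 1; have h2 := par_x1_eval hC 'X 1.
by have hw := par_w_eval hC 'X 1; rewrite hX h1 in h0 h2 hw; split.
Qed.

Lemma par_x_comb_neq0 z w : (z != 0) || (w != 0) ->
  z%:P * par_x0 polyC 'X 1 + w%:P * par_x1 polyC 'X 1 != 0.
Proof.
move=> zw.
have -> : z%:P * par_x0 polyC 'X 1 + w%:P * par_x1 polyC 'X 1
    = (z * xi0 + w * xi1)%:P * par_a polyC 'X 1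
      + (z * eta0 + w * eta1)%:P * par_b polyC 'X 1.
  by rewrite /par_x0 /par_x1 !(polyCD, polyCM); ring.
apply: par_comb_neq0; apply: contraLR zw; rewrite !negb_or !negbK => /andP[/eqP h1 /eqP h2].
have hz : z * (xi0 * eta1 - xi1 * eta0) = 0.
  transitivity ((z * xi0 + w * xi1) * eta1 - (z * eta0 + w * eta1) * xi1); first by ring.
  by rewrite h1 h2 !mul0r subrr.
have hw : w * (xi0 * eta1 - xi1 * eta0) = 0.
  transitivity ((z * eta0 + w * eta1) * xi0 - (z * xi0 + w * xi1) * eta0); first by ring.
  by rewrite h1 h2 !mul0r subrr.
move/eqP: hz; rewrite mulf_eq0 (negPf xi_eta) orbF => ->.
by move/eqP: hw; rewrite mulf_eq0 (negPf xi_eta) orbF => ->.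
Qed.

Lemma par_w_neq0 : par_w polyC 'X 1 != 0.
Proof.
rewrite mulf_neq0 //.
  have := @par_x_comb_neq0 1 (- t); rewrite oner_neq0 => /(_ isT).
  by rewrite /par_lin polyCN mul1r mulNr.
apply/eqP => h.
have [] := @quadratic_poly_eq0 s (- r) (s * q).
  by rewrite -[RHS]h /par_s -!mul_polyC polyCN; ring.
by move=> s0 /eqP; rewrite oppr_eq0 => r0 _; move: sr; rewrite s0 r0 eqxx.
Qed.

(** The bisection dominates the base: [par_x0] and [par_x1] are independent, since xi and eta
    are. *)
Lemma bisection_avoids (S : seq k) :
  exists x, [/\ X1 x 1 != 0, par_w id x 1 != 0 & X0 x 1 / X1 x 1 \notin S].
Proof.
have [|y|x []] := ratio_avoids k_infinite (N := par_x0 polyC 'X 1)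
    (D := par_x1 polyC 'X 1) S par_w_neq0.
- have := @par_x_comb_neq0 0 1; rewrite oner_neq0 orbT => /(_ isT).
  by rewrite mul0r add0r mul1r.
- have := @par_x_comb_neq0 1 (- y); rewrite oner_neq0 => /(_ isT).
  by rewrite mul1r polyCN mulNr mul_polyC.
by have [-> -> ->] := par_horner x => xw xx1 xS; exists x.
Qed.

(** The ratio is not constant in the slope: in numerator minus y times denominator, the coefficient
    of l is 2 w for every y. *)
Lemma fibre_avoids x (S : seq k) : par_w id x 1 != 0 ->
  exists l, par_y0 id x 1 l != 0 /\ par_y id x 1 l / par_y0 id x 1 l \notin S.
Proof.
move=> wn0; rewrite /par_y0 /par_y /=.
move: (par_w id x 1) (par_disc1 id x 1) (par_disc2 id x 1) wn0 => w b d wn0.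
have DE : d%:P - 'X^2
   = (-1) *: 'X^2 + 0 *: 'X + d%:P.
  by rewrite scale0r addr0 scaleN1r addrC.
have [|y|l [_]] := ratio_avoids k_infinite S (oner_neq0 _)
   (N := (2%:R * w)%:P * 'X - b%:P)
   (D := d%:P - 'X^2).
- apply/eqP; rewrite DE => /quadratic_poly_eq0 [/eqP].
  by rewrite oppr_eq0 oner_eq0.
- apply/eqP => h.
  have [] := @quadratic_poly_eq0 y (2%:R * w) (- b - y * d).
    by rewrite -[RHS]h -!mul_polyC !(polyCB, polyCN, polyCM); ring.
  by move=> _ /eqP; rewrite mulf_eq0 (negPf char2) (negPf wn0).
rewrite !hornerE => Dl Nl; exists l; split=> //.
by rewrite (mulrA 2%:R).
Qed.

(** The slope is homogenized to degree 4, the degree of [par_w], and becomes the free parameter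
    ['X_2] where ['X_1] is 1. *)
Definition par_map : 5.-tuple {mpoly k[3]} :=
  let iota := @mpolyC 3 k in
  let l := 'X_2 * 'X_1 ^+ 3 in
  [tuple par_x0 iota 'X_0 'X_1; par_x1 iota 'X_0 'X_1; par_y0 iota 'X_0 'X_1 l;
         par_y1 iota 'X_0 'X_1 l; par_y2 iota 'X_0 'X_1 l].

Lemma par_map_eval (F : {mpoly k[5]}) (p : 'I_3 -> k) :
  (F \mPo par_map).@[p]
  = let l := p 2 * p 1 ^+ 3 in
    F.@[point5 (X0 (p 0) (p 1)) (X1 (p 0) (p 1)) (par_y0 id (p 0) (p 1) l)
          (par_y1 id (p 0) (p 1) l) (par_y2 id (p 0) (p 1) l)].
Proof.
rewrite comp_mpoly_meval; apply: meval_eq => i.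
have hC a' : meval p (mpolyC 3 a') = a' by rewrite mevalC.
have hl : ('X_2 * 'X_1 ^+ 3).@[p] = p 2 * p 1 ^+ 3 by rewrite mevalM mevalXn !mevalXU.
rewrite -hl -!(mevalXU p) (tnth_nth 0) /point5.
rewrite -(par_x0_eval hC) -(par_x1_eval hC) -(par_y0_eval hC) -(par_y1_eval hC).
rewrite -(par_y2_eval hC).
by case: i => [[|[|[|[|[|//]]]]] hi].
Qed.

Lemma conic_bundle_par_map : conic_bundle c \mPo par_map = 0.
Proof.
apply: (mpoly_eq0_eval k_infinite) => p.
by rewrite par_map_eval /= conic_bundle_eval /point5 /= par_on_conic.
Qed.

(** The torus action is included so that x1 and y0 can be prescribed later. *)
Definition vanishes_on_par (G : {mpoly k[5]}) : Prop := forall l m x lam,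
  G.@[point5 (l * X0 x 1) (l * X1 x 1) (m * par_y0 id x 1 lam)
        (m * par_y1 id x 1 lam) (l ^+ 2 * m * par_y2 id x 1 lam)] = 0.

Lemma bihomogeneous_vanishes ab (G : {mpoly k[5]}) :
  bihomogeneous ab G -> G \mPo par_map = 0 -> vanishes_on_par G.
Proof.
move=> hG G0 l m x lam; apply: bihomogeneous_scale hG _.
have := par_map_eval G (fun i : 'I_3 => nth 0 [:: x; 1; lam] i).
by rewrite G0 meval0 /= expr1n mulr1.
Qed.

Lemma conic_bundle_vanishes : vanishes_on_par (conic_bundle c).
Proof.
move=> l m x lam; rewrite conic_bundle_eval /point5 /=.
transitivity (l ^+ 4 * m ^+ 2 * conic e (X0 x 1) (X1 x 1) (par_y0 id x 1 lam)
                (par_y1 id x 1 lam) (par_y2 id x 1 lam)).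
  by rewrite /conic /quartic /quadric; ring.
by rewrite par_on_conic mulr0.
Qed.

Lemma vanishes_on_fibre G l x Y0 Y W : vanishes_on_par G ->
  par_disc1 id x 1 ^+ 2 - 4%:R * par_w id x 1 ^+ 2 * par_disc2 id x 1 != 0 ->
  Y != 0 ->
  W ^+ 2 = par_w id x 1 ^+ 2 * Y0 ^+ 2 + par_disc1 id x 1 * Y0 * Y
           + par_disc2 id x 1 * Y ^+ 2 ->
  G.@[point5 (l * X0 x 1) (l * X1 x 1) Y0 (u * Y0 + Y)
        (l ^+ 2 * (g * (W - par_quadric id x 1 10 * Y0
                          - par_quadric id x 1 18 * (u * Y0 + Y))))] = 0.
Proof.
move=> hG dn0 Yn0 hW; have [m [lam [-> -> ->]]] := par_surjective dn0 Yn0 hW.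
rewrite -[RHS](hG l m x lam); congr (_.@[point5 _ _ _ _ _]).
  by rewrite /par_y1; ring.
by rewrite /par_y2 /par_y1; ring.
Qed.

(* The points with coordinates [W] and [- W] lie on the same fibre, so both
   coefficients of the remainder vanish. *)
Lemma remainder_vanishes H (R0 R1 : {mpoly k[4]}) l m x lam :
  vanishes_on_par (H * conic_bundle c + mwiden R0 + mwiden R1 * 'X_4) ->
  par_disc1 id x 1 ^+ 2 - 4%:R * par_w id x 1 ^+ 2 * par_disc2 id x 1 != 0 ->
  l != 0 -> m != 0 -> par_y id x 1 lam != 0 -> par_W id x 1 lam != 0 ->
  let p := point4 (l * X0 x 1) (l * X1 x 1) (m * par_y0 id x 1 lam) (m * par_y1 id x 1 lam) in
  R0.@[p] = 0 /\ R1.@[p] = 0.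
Proof.
move=> hG dn0 l0 m0 Yn0 Wn0 p.
pose Y0 := m * par_y0 id x 1 lam; pose Y := m * par_y id x 1 lam.
pose W := m * par_W id x 1 lam.
have hW : W ^+ 2 = par_w id x 1 ^+ 2 * Y0 ^+ 2 + par_disc1 id x 1 * Y0 * Y
           + par_disc2 id x 1 * Y ^+ 2.
  by rewrite /W /Y0 /Y /par_W /par_y0 /par_y /=; ring.
have hW' : (- W) ^+ 2 = par_w id x 1 ^+ 2 * Y0 ^+ 2 + par_disc1 id x 1 * Y0 * Y
           + par_disc2 id x 1 * Y ^+ 2 by rewrite sqrrN.
have Y_n0 : Y != 0 by rewrite mulf_neq0.
have hp : p =1 point4 (l * X0 x 1) (l * X1 x 1) Y0 (u * Y0 + Y).
  have E : m * par_y1 id x 1 lam = u * Y0 + Y by rewrite /par_y1 /Y0 /Y; ring.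
  by rewrite /p E.
have E1 := vanishes_on_fibre l hG dn0 Y_n0 hW.
have E2 := vanishes_on_fibre l hG dn0 Y_n0 hW'.
have Q1 := vanishes_on_fibre l conic_bundle_vanishes dn0 Y_n0 hW.
have Q2 := vanishes_on_fibre l conic_bundle_vanishes dn0 Y_n0 hW'.
rewrite 2!mevalD 2!mevalM Q1 mulr0 add0r mevalXU !meval_mwiden_point in E1.
rewrite 2!mevalD 2!mevalM Q2 mulr0 add0r mevalXU !meval_mwiden_point in E2.
rewrite -!(meval_eq _ hp) in E1 E2; rewrite /point5 /= in E1 E2.
(* The two points differ only in y2, by l^2 g (2 W). *)
have R10 : R1.@[p] = 0.
  have fW : l ^+ 2 * g * (2%:R * W) != 0.
    by rewrite !mulf_neq0 ?expf_neq0 // gE invr_eq0 mulf_neq0.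
  apply: (mulIf fW); rewrite mul0r -[RHS](subrr 0) -{1}E1 -E2; ring.
by split=> //; move: E1; rewrite R10 mul0r addr0.
Qed.

Let ce i : {mpoly k[4]} := (e i)%:MP.
Let Y' : {mpoly k[4]} := 'X_3 - u%:MP * 'X_2.

(** The remainder is multiplied by this polynomial to discard the points out of reach: x1 = 0, y0 =
    0, the bisection [Y'] = 0, the fibres whose binary form has zero discriminant, and the branch
    points, where W and - W coincide. *)
Definition bad_locus : {mpoly k[4]} :=
  'X_1 * 'X_2 * Y'
  * (disc1 ce u%:MP 'X_0 'X_1 ^+ 2
     - 4%:R * disc0 ce u%:MP 'X_0 'X_1 * disc2 ce 'X_0 'X_1)
  * (disc0 ce u%:MP 'X_0 'X_1 * 'X_2 ^+ 2 + disc1 ce u%:MP 'X_0 'X_1 * 'X_2 * Y'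
     + disc2 ce 'X_0 'X_1 * Y' ^+ 2).

Lemma bad_locus_eval x0 x1 y0 y1 :
  bad_locus.@[point4 x0 x1 y0 y1]
  = x1 * y0 * (y1 - u * y0)
  * (disc1 e u x0 x1 ^+ 2 - 4%:R * disc0 e u x0 x1 * disc2 e x0 x1)
  * (disc0 e u x0 x1 * y0 ^+ 2 + disc1 e u x0 x1 * y0 * (y1 - u * y0)
     + disc2 e x0 x1 * (y1 - u * y0) ^+ 2).
Proof.
set p := point4 _ _ _ _.
have hC i : meval p (ce i) = e i by rewrite /ce mevalC.
have pX0 : ('X_0 : {mpoly k[4]}).@[p] = x0 by rewrite mevalXU.
have pX1 : ('X_1 : {mpoly k[4]}).@[p] = x1 by rewrite mevalXU.
have pX2 : ('X_2 : {mpoly k[4]}).@[p] = y0 by rewrite mevalXU.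
have pX3 : ('X_3 : {mpoly k[4]}).@[p] = y1 by rewrite mevalXU.
have h0 := rmorph_disc0 (f := meval p) hC u%:MP 'X_0 'X_1.
have h1 := rmorph_disc1 (f := meval p) hC u%:MP 'X_0 'X_1.
have h2 := rmorph_disc2 (f := meval p) hC 'X_0 'X_1.
rewrite /= mevalC pX0 pX1 in h0 h1; rewrite /= pX0 pX1 in h2.
rewrite /bad_locus /Y' -h0 -h1 -h2.
move: (disc0 _ _ _ _) (disc1 _ _ _ _) (disc2 _ _ _) => A B C.
rewrite -pX1 -pX2 -pX3.
move: ('X_1 : {mpoly k[4]}) ('X_2 : {mpoly k[4]}) ('X_3 : {mpoly k[4]}) => T1 T2 T3.
pose f : {rmorphism {mpoly k[4]} -> k} := meval p.
have fu : f u%:MP = u by rewrite /f /= mevalC.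
rewrite -![meval p _]/(f _); move: f fu => f fu.
by rewrite !(rmorph_nat, rmorphB, rmorphXn, rmorphD, rmorphM) !fu.
Qed.

Lemma disc0_t : disc0 e u t 1 = 0.
Proof. by rewrite disc0_a mulr1 subrr expr0n mul0r. Qed.

(** Over the point of tangency [disc0] vanishes and [disc1] does not, so the discriminant of the
    binary form is the nonzero square of [disc1]. This is where smoothness of the sextic at the
    given point enters. *)
Lemma bad_locus_neq0 : bad_locus != 0.
Proof.
suff [y0 [y00 hy]] : exists y0, y0 != 0 /\ disc1 e u t 1 * y0 + disc2 e t 1 != 0.
  have E : bad_locus.@[point4 t 1 y0 (u * y0 + 1)]
      = y0 * disc1 e u t 1 ^+ 2 * (disc1 e u t 1 * y0 + disc2 e t 1).
    by rewrite bad_locus_eval disc0_t; ring.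
  apply/eqP => h; move: E; rewrite h meval0 => /esym/eqP; apply/negP.
  by rewrite !mulf_neq0 // expf_neq0.
move: (disc1 e u t 1) (disc2 e t 1) disc1_t => b d b0.
(* The solution of b y0 + d = 1 is zero when d = 1; then b y0 = 1 is taken instead, and the sum 2 is
   nonzero. *)
case: (eqVneq d 1) => [->|d1].
  by exists b^-1; rewrite invr_eq0 b0 mulfV // -mulr2n.
exists ((1 - d) / b); split.
  by rewrite mulf_neq0 ?invr_eq0 // subr_eq0 eq_sym.
by rewrite (_ : _ + d = 1) ?oner_neq0 //; field.
Qed.

(** For fixed nonzero x1 and y0 the product with [bad_locus] is a polynomial in x0 and, over the
    base points reached by the bisection, one in y1; each is shown to have infinitely many zeros. *)
Lemma remainder_eq0 (R : {mpoly k[4]}) :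
  (forall l m x lam,
     par_disc1 id x 1 ^+ 2 - 4%:R * par_w id x 1 ^+ 2 * par_disc2 id x 1 != 0 ->
     l != 0 -> m != 0 -> par_y id x 1 lam != 0 -> par_W id x 1 lam != 0 ->
     R.@[point4 (l * X0 x 1) (l * X1 x 1) (m * par_y0 id x 1 lam)
           (m * par_y1 id x 1 lam)] = 0) ->
  R = 0.
Proof.
move=> hR.
have core l m x lam : (R * bad_locus).@[point4 (l * X0 x 1) (l * X1 x 1)
    (m * par_y0 id x 1 lam) (m * par_y1 id x 1 lam)] = 0.
  rewrite mevalM bad_locus_eval.
  have -> : m * par_y1 id x 1 lam - u * (m * par_y0 id x 1 lam) = m * par_y id x 1 lam.
    by rewrite /par_y1; ring.
  have [-> -> ->] := disc_scale e u l (X0 x 1) (X1 x 1).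
  rewrite par_disc0E par_disc1E par_disc2E.
  have -> : (l ^+ 4 * par_disc1 id x 1) ^+ 2
      - 4%:R * (l ^+ 4 * par_w id x 1 ^+ 2) * (l ^+ 4 * par_disc2 id x 1)
    = l ^+ 8 * (par_disc1 id x 1 ^+ 2 - 4%:R * par_w id x 1 ^+ 2 * par_disc2 id x 1).
    ring.
  have -> : l ^+ 4 * par_w id x 1 ^+ 2 * (m * par_y0 id x 1 lam) ^+ 2
      + l ^+ 4 * par_disc1 id x 1 * (m * par_y0 id x 1 lam) * (m * par_y id x 1 lam)
      + l ^+ 4 * par_disc2 id x 1 * (m * par_y id x 1 lam) ^+ 2
    = l ^+ 4 * m ^+ 2 * par_W id x 1 lam ^+ 2.
    by rewrite /par_W /par_y /par_y0 /=; ring.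
  case: (eqVneq l 0) => [->|l0]; first by rewrite !(mulr0, mul0r).
  case: (eqVneq m 0) => [->|m0]; first by rewrite !(mulr0, mul0r).
  case: (eqVneq (par_y id x 1 lam) 0) => [->|y_n0]; first by rewrite !(mulr0, mul0r).
  case: (eqVneq (par_W id x 1 lam) 0) => [->|W_n0]; first by rewrite expr0n !(mulr0, mul0r).
  pose d := par_disc1 id x 1 ^+ 2 - 4%:R * par_w id x 1 ^+ 2 * par_disc2 id x 1.
  rewrite -/d; case: (eqVneq d 0) => [->|d_n0]; first by rewrite !(mulr0, mul0r).
  by rewrite hR // mul0r.
suff : R * bad_locus = 0.
  by move/eqP; rewrite mulf_eq0 (negPf bad_locus_neq0) orbF => /eqP.
apply: (mpoly_eq0_eval k_infinite) => p; rewrite (meval_eq _ (point4E p)).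
move: (p 0) (p 1) (p 2) (p 3) => x0 x1 y0 y1.
case: (eqVneq x1 0) => [->|x1n0]; first by rewrite mevalM bad_locus_eval !mul0r mulr0.
case: (eqVneq y0 0) => [->|y0n0].
  by rewrite mevalM bad_locus_eval mulr0 !mul0r mulr0.
have [qx qxE] := meval_horner (R * bad_locus)
  (fun i : 'I_4 => nth 0 [:: 'X; x1%:P; y0%:P; y1%:P] i).
have {}qxE z : qx.[z] = (R * bad_locus).@[point4 z x1 y0 y1].
  by rewrite qxE; apply: meval_eq; apply: ord4_cases; rewrite /= ?hornerX ?hornerC.
rewrite -qxE; suff -> : qx = 0 by rewrite horner0.
apply: poly_eq0_infinite => S.
have [x [xx1 xw xS]] := bisection_avoids [seq z / x1 | z <- S].
exists (x1 * (X0 x 1 / X1 x 1)); last first.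
  apply: contra xS => xS; apply/mapP; exists (x1 * (X0 x 1 / X1 x 1)) => //.
  by rewrite [X in X / x1]mulrC mulfK.
rewrite qxE.
have [qy qyE] := meval_horner (R * bad_locus)
  (fun i : 'I_4 => nth 0 [:: (x1 * (X0 x 1 / X1 x 1))%:P; x1%:P; y0%:P; 'X] i).
have {}qyE z : qy.[z] = (R * bad_locus).@[point4 (x1 * (X0 x 1 / X1 x 1)) x1 y0 z].
  by rewrite qyE; apply: meval_eq; apply: ord4_cases; rewrite /= ?hornerX ?hornerC.
rewrite -qyE; suff -> : qy = 0 by rewrite horner0.
apply: poly_eq0_infinite => S'.
have [lam [ly0 lS]] := fibre_avoids [seq z / y0 - u | z <- S'] xw.
exists (y0 * (u + par_y id x 1 lam / par_y0 id x 1 lam)); last first.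
  apply: contra lS => lS; apply/mapP.
  exists (y0 * (u + par_y id x 1 lam / par_y0 id x 1 lam)) => //.
  by rewrite [X in X / y0]mulrC mulfK // addrC addKr.
(* These scalings restore the prescribed x1 and y0. *)
rewrite qyE -[RHS](core (x1 / X1 x 1) (y0 / par_y0 id x 1 lam) x lam).
congr (_.@[point4 _ _ _ _]).
- by rewrite mulrA mulrAC.
- by rewrite divfK.
- by rewrite divfK.
by rewrite /par_y1; field.
Qed.

Lemma par_map_dominant ab (G : {mpoly k[5]}) :
  bihomogeneous ab G -> G \mPo par_map = 0 -> mdvd (conic_bundle c) G.
Proof.
move=> hG G0; have [H [R0 [R1 GE]]] := conic_bundle_division k_infinite G f0.
have hv := bihomogeneous_vanishes hG G0; rewrite GE in hv.
have R00 : R0 = 0.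
  apply: remainder_eq0 => l m x lam d0 l0 m0 y_0 W0.
  by have [] := remainder_vanishes hv d0 l0 m0 y_0 W0.
have R10 : R1 = 0.
  apply: remainder_eq0 => l m x lam d0 l0 m0 y_0 W0.
  by have [] := remainder_vanishes hv d0 l0 m0 y_0 W0.
by exists H; rewrite GE R00 R10 !mwiden0 mul0r !addr0.
Qed.

Lemma par_unirational : unirational c.
Proof.
have hX := dhomogXU k (0 : 'I_3); have hY := dhomogXU k (1 : 'I_3).
have hl : ('X_2 * 'X_1 ^+ 3 : {mpoly k[3]}) \is 4.-homog.
  have hZ := dhomogXU k (2 : 'I_3); move: ('X_2) ('X_1) hZ hY => a' b' ha hb.
  by solve_homog.
have [hx0 hx1] := par_x_dhomog hX hY.
have [hy0 hy1 hy2] := par_y_dhomog hX hY hl.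
have hF (i : 'I_5) : tnth par_map i = 0 -> forall x lam,
    point5 (X0 x 1) (X1 x 1) (par_y0 id x 1 lam) (par_y1 id x 1 lam) (par_y2 id x 1 lam) i = 0.
  move=> h x lam; have := par_map_eval 'X_i (fun j : 'I_3 => nth 0 [:: x; 1; lam] j).
  by rewrite comp_mpolyXU -tnth_nth h meval0 /= mevalXU expr1n mulr1.
have [x [xx1 _ _]] := bisection_avoids [::].
exists 2%N, 2%N, 8%N, par_map; split.
- by split; rewrite (tnth_nth 0).
- by move=> [_ /hF /(_ x 0)] /eqP; rewrite /point5 /= (negPf xx1).
(* At the slopes 0 and 1 the values of [par_y0] differ by 1, so they are not both zero. *)
- move=> [/hF h _ _]; have := h x 0; have := h x 1; rewrite /point5 /par_y0 /= expr1n expr0n subr0.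
  by move=> h1 h2; move: h1; rewrite h2 sub0r => /eqP; rewrite oppr_eq0 oner_eq0.
- exact: conic_bundle_par_map.
exact: par_map_dominant.
Qed.

End Parametrization.

(** * A point on the bisection over a C_1 field *)

(** The ternary quadratic form s^2 - a(x0, x1) has a nontrivial zero, and x0 = x1 = 0 would force s
    = 0. *)
Lemma C1_represents_square (k : fieldType) (k_C1 : C1_field k) (a : nat -> k) :
  exists x0 x1 s, (x0 != 0) || (x1 != 0) /\ quadric a 0 x0 x1 = s ^+ 2.
Proof.
pose F : {mpoly k[3]} := 'X_2 ^+ 2 - quadric (fun i => (a i)%:MP) 0 'X_0 'X_1.
have hF : F \is 2.-homog.
  have := quadric_dhomog a 0 (dhomogXU _ 0) (dhomogXU k (1 : 'I_3)).
  rewrite /F; move: (quadric _ _ _ _) => G hG.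
  have hX := dhomogXU k (2 : 'I_3); move: ('X_2) hX => X hX; solve_homog.
have [v [i vi] Fv] := k_C1 2%N 3%N F isT hF.
have sE : quadric a 0 (v 0) (v 1) = v 2 ^+ 2.
  have := Fv; rewrite mevalB mevalXn mevalXU (rmorph_quadric (f := meval v) (e' := a)).
    by rewrite /= !mevalXU => /eqP; rewrite subr_eq0 => /eqP.
  by move=> j; rewrite /= mevalC.
exists (v 0), (v 1), (v 2); split=> //.
rewrite -negb_and; apply: contra vi => /andP[/eqP v0 /eqP v1].
have /eqP v2 : v 2 == 0.
  by move: sE; rewrite v0 v1 /quadric !(mulr0, mul0r, expr0n, addr0) => /esym/eqP; rewrite expf_eq0.
by case: i => [[|[|[|//]]] hi]; apply/eqP; [rewrite -[RHS]v0 | rewrite -[RHS]v1 | rewrite -[RHS]v2];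
  congr v; apply/val_inj.
Qed.

Lemma tangency_unirational (k : fieldType) (k_infinite : infinite_field k)
    (k_C1 : C1_field k) (c : 'I_22 -> k) (t u v : k) :
  (2%:R : k) != 0 -> coef c 21 != 0 -> tangency c t u v ->
  let a := residual (disc0_coef (coef c) u) t in
  a 1%N ^+ 2 - 4%:R * a 0%N * a 2%N != 0 -> unirational c.
Proof.
move=> char2 f0 T; have [d0 d1 b0] := tangency_disc char2 f0 T.
move E : (residual _ _) => a /= a_disc.
have [xi0 [xi1 [s [xi_n0 sE]]]] := C1_represents_square k_C1 a.
have [eta0 [eta1 det]] : exists eta0 eta1, xi0 * eta1 - xi1 * eta0 != 0.
  case/orP: xi_n0 => h; first by exists 0, 1; rewrite mulr0 subr0 mulr1.
  by exists (-1), 0; rewrite mulr0 sub0r mulrN1 opprK.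
pose r := 2%:R * a 2%N * xi0 * eta0 + a 1%N * (xi0 * eta1 + xi1 * eta0)
          + 2%:R * a 0%N * xi1 * eta1.
apply: (@par_unirational k c t u xi0 xi1 eta0 eta1 s (quadric a 0 eta0 eta1) r
  (2%:R * coef c 21)^-1 a) => //.
  by move=> x0 x1; rewrite disc0E (quartic_double_root d0 d1) E.
rewrite -negb_and; apply: contra a_disc => /andP[/eqP s0 /eqP r0].
(* In the basis (xi, eta) the discriminant is multiplied by the square of the determinant; it would
   vanish if s = r = 0. *)
have D : (a 1%N ^+ 2 - 4%:R * a 0%N * a 2%N) * (xi0 * eta1 - xi1 * eta0) ^+ 2 = 0.
  transitivity (r ^+ 2 - 4%:R * quadric a 0 xi0 xi1 * quadric a 0 eta0 eta1).
    by rewrite /r /quadric; ring.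
  by rewrite sE s0 r0 !expr0n !(mulr0, mul0r) subrr.
by move/eqP: D; rewrite mulf_eq0 expf_eq0 (negPf det) orbF.
Qed.

(** * Discriminants that are a constant times a square, and their resultant *)

(* Two of the cubic equations satisfied by the coefficients of [const * (quadratic) ^ 2]. *)
Definition square_eq1 (R : comNzRingType) (a : nat -> R) : R :=
  a 1%N ^+ 2 * a 4%N - a 0%N * a 3%N ^+ 2.

Definition square_eq2 (R : comNzRingType) (a : nat -> R) : R :=
  a 3%N ^+ 3 - 4%:R * a 2%N * a 3%N * a 4%N + 8%:R * a 1%N * a 4%N ^+ 2.

(** Once the double zero is factored out, both cubics are explicit multiples of the discriminant of
    the residual quadratic. *)
Lemma square_eq_residual (R : comNzRingType) (a : nat -> R) (t : R) :
  quartic a 0 t 1 = 0 -> quartic_dx a 0 t 1 = 0 ->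
  let r := residual a t in
  r 1%N ^+ 2 - 4%:R * r 0%N * r 2%N = 0 -> square_eq1 a = 0 /\ square_eq2 a = 0.
Proof.
move=> h0 h1 r rd; have [e1 e0] := double_root_coef h0 h1.
rewrite -/r in e1 e0.
have e4 : a 4%N = r 2%N by [].
have e3 : a 3%N = r 1%N - 2%:R * t * r 2%N by rewrite /r /residual /=; ring.
have e2 : a 2%N = r 0%N - 2%:R * t * r 1%N + t ^+ 2 * r 2%N.
  by rewrite /r /residual /=; ring.
split.
  transitivity ((r 1%N ^+ 2 - 4%:R * r 0%N * r 2%N) * (t ^+ 2 * (t ^+ 2 * r 2%N - r 0%N))).
    by rewrite /square_eq1 e0 e1 e3 e4; ring.
  by rewrite rd mul0r.
transitivity ((r 1%N ^+ 2 - 4%:R * r 0%N * r 2%N) * (r 1%N + 2%:R * t * r 2%N)).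
  by rewrite /square_eq2 e1 e2 e3 e4; ring.
by rewrite rd mul0r.
Qed.

Lemma rmorph_square_eq (R S : comNzRingType) (f : {rmorphism R -> S})
    (a : nat -> R) (a' : nat -> S) : (forall i, f (a i) = a' i) ->
  f (square_eq1 a) = square_eq1 a' /\ f (square_eq2 a) = square_eq2 a'.
Proof.
move=> fa; split; rewrite /square_eq1 /square_eq2.
  by rewrite !(rmorphB, rmorphXn, rmorphM) !fa.
by rewrite !(rmorph_nat, rmorphB, rmorphXn, rmorphD, rmorphM) !fa.
Qed.

Lemma rmorph_disc0_coef (R S : comNzRingType) (f : {rmorphism R -> S})
    (e : nat -> R) (e' : nat -> S) u i : (forall i, f (e i) = e' i) ->
  f (disc0_coef e u i) = disc0_coef e' (f u) i.
Proof.
move=> fe; rewrite /disc0_coef.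
case: i => [|[|[|[|[|i]]]]] /=; last by rewrite !nth_nil rmorph0.
all: by rewrite !(rmorph_nat, rmorphB, rmorphXn, rmorphD, rmorphM) !fe.
Qed.

Section SizeBounds.
Variable R : comNzRingType.
Implicit Types p q : {poly R}.

Lemma size_add_leq p q n : (size p <= n)%N -> (size q <= n)%N -> (size (p + q)%R <= n)%N.
Proof. by move=> hp hq; rewrite (leq_trans (size_polyD _ _)) // geq_max hp. Qed.

Lemma size_opp_leq p n : (size p <= n)%N -> (size (- p)%R <= n)%N.
Proof. by rewrite size_polyN. Qed.

Lemma size_mul_leq_deg p q m n : (size p <= m.+1)%N -> (size q <= n.+1)%N ->
  (size (p * q)%R <= (m + n).+1)%N.
Proof.
move=> hp hq; apply: leq_trans (size_polyMleq _ _) _.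
by move: hp hq; move: (size p) (size q) => i j hi hj; lia.
Qed.

Lemma size_exp_leq_deg p m n : (size p <= m.+1)%N -> (size (p ^+ n)%R <= (m * n).+1)%N.
Proof.
move=> hp; elim: n => [|n IH]; first by rewrite expr0 size_poly1.
by rewrite exprS mulnS; apply: size_mul_leq_deg.
Qed.

Lemma size_natr_leq m : (size (m%:R : {poly R})%R <= 1)%N.
Proof. by rewrite -polyC_natr size_polyC_leq1. Qed.

Lemma disc0_coef_size (e : nat -> R) i :
  (size (disc0_coef (fun j => (e j)%:P) 'X i) <= 3)%N.
Proof.
have hX : (size ('X : {poly R}) <= 1.+1)%N by rewrite size_polyX.
have hC j : (size (e j)%:P <= 1)%N by apply: size_polyC_leq1.
have hl j : (size ((e (10 + j)%N)%:P + 'X * (e (18 + j)%N)%:P)%R <= 2)%N.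
  apply: size_add_leq; first exact: leq_trans (hC _) _.
  exact: (size_mul_leq_deg hX (hC _)).
have hq j : (size ((e j)%:P + 'X * (e (5 + j)%N)%:P + 'X ^+ 2 * (e (13 + j)%N)%:P)%R <= 3)%N.
  apply: size_add_leq; last exact: (size_mul_leq_deg (size_exp_leq_deg 2 hX) (hC _)).
  apply: size_add_leq; first exact: leq_trans (hC _) _.
  exact: leq_trans (size_mul_leq_deg hX (hC _)) _.
have hf : (size (4%:R * (e 21%N)%:P : {poly R})%R <= 1)%N.
  exact: (size_mul_leq_deg (size_natr_leq 4) (hC _)).
have h2 j l : (size (2%:R * ((e (10 + j)%N)%:P + 'X * (e (18 + j)%N)%:P)
                     * ((e (10 + l)%N)%:P + 'X * (e (18 + l)%N)%:P))%R <= 3)%N.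
  exact: (size_mul_leq_deg (size_mul_leq_deg (size_natr_leq 2) (hl _)) (hl _)).
have hs j : (size (((e (10 + j)%N)%:P + 'X * (e (18 + j)%N)%:P) ^+ 2)%R <= 3)%N.
  exact: (size_exp_leq_deg 2 (hl _)).
have hfq j := size_opp_leq (size_mul_leq_deg hf (hq j)).
rewrite /disc0_coef; case: i => [|[|[|[|[|i]]]]] /=; last by rewrite nth_nil size_poly0.
- exact: size_add_leq (hs 0%N) (hfq 0%N).
- exact: size_add_leq (h2 0%N 1%N) (hfq 1%N).
- exact: size_add_leq (size_add_leq (hs 1%N) (h2 0%N 2%N)) (hfq 2%N).
- exact: size_add_leq (h2 1%N 2%N) (hfq 3%N).
exact: size_add_leq (hs 2%N) (hfq 4%N).
Qed.

(** Cubics in coefficients of degree at most 2 in u have degree at most 6; hence the coefficients of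
    index 6 below. *)
Lemma square_eq_size (a : nat -> {poly R}) : (forall i, (size (a i) <= 3)%N) ->
  (size (square_eq1 a) <= 7)%N /\ (size (square_eq2 a) <= 7)%N.
Proof.
move=> ha; split; rewrite /square_eq1 /square_eq2.
  apply: size_add_leq; first exact: (size_mul_leq_deg (size_exp_leq_deg 2 (ha _)) (ha _)).
  exact: size_opp_leq (size_mul_leq_deg (ha _) (size_exp_leq_deg 2 (ha _))).
apply: size_add_leq; last first.
  exact: (size_mul_leq_deg (size_mul_leq_deg (size_natr_leq 8) (ha _)) (size_exp_leq_deg 2 (ha _))).
apply: size_add_leq; first exact: (size_exp_leq_deg 3 (ha _)).
apply: size_opp_leq.
exact: (size_mul_leq_deg (size_mul_leq_deg (size_mul_leq_deg (size_natr_leq 4) (ha _)) (ha _)) (ha _)).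
Qed.

End SizeBounds.

(* [map_resultant] is stated for morphisms defined on a ring of polynomials only. *)
Lemma rmorph_resultant (aR rR : nzRingType) (f : {rmorphism aR -> rR}) (p q : {poly aR}) :
  f (lead_coef p) != 0 -> f (lead_coef q) != 0 ->
  f (resultant p q) = resultant (map_poly f p) (map_poly f q).
Proof.
move=> fp fq; rewrite /resultant /Sylvester_mx !size_map_poly_id0 // -det_map_mx.
congr (\det _); rewrite map_col_mx; congr (col_mx _ _); apply: map_lin1_mx => v;
  by rewrite map_poly_rV rmorphM /= map_rVpoly.
Qed.

Section Resultant.
Variable (k : fieldType).

Let generic (i : nat) : {mpoly k[22]} := 'X_(inord i).
Let pencil (i : nat) : {poly {mpoly k[22]}} := disc0_coef (fun j => (generic j)%:P) 'X i.

(* It vanishes on [c] when some [disc0 (coef c) u] is a constant times a square. *)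
Definition square_resultant : {mpoly k[22]} :=
  resultant (square_eq1 pencil) (square_eq2 pencil).

Let special (c : 'I_22 -> k) (i : nat) : {poly k} :=
  disc0_coef (fun j => (coef c j)%:P) 'X i.

Let pencil_special c :
  map_poly (meval c) (square_eq1 pencil) = square_eq1 (special c) /\
  map_poly (meval c) (square_eq2 pencil) = square_eq2 (special c).
Proof.
apply: (rmorph_square_eq (f := map_poly (meval c))) => i.
rewrite /pencil (rmorph_disc0_coef (f := map_poly (meval c)) (e' := fun j => (coef c j)%:P)) /=.
  by rewrite map_polyX.
by move=> j; rewrite map_polyC /= mevalXU.
Qed.

Let special_eval c u :
  (square_eq1 (special c)).[u] = square_eq1 (disc0_coef (coef c) u) /\
  (square_eq2 (special c)).[u] = square_eq2 (disc0_coef (coef c) u).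
Proof.
pose h : {rmorphism {poly k} -> k} := horner_eval u.
apply: (rmorph_square_eq (f := h)) => i.
rewrite /special (rmorph_disc0_coef (f := h) (e' := coef c)) /h /= /horner_eval.
  by rewrite hornerX.
by move=> j; rewrite hornerC.
Qed.

(** The resultant is compatible with a specialization that keeps the leading coefficients. Nonzero
    coefficients of index 6 at one [c] show both that the generic degrees are 6 and that they are
    kept at this [c]. *)
Let lead_meval c : (square_eq1 (special c))`_6 != 0 -> (square_eq2 (special c))`_6 != 0 ->
  [/\ size (square_eq1 pencil) = 7, size (square_eq2 pencil) = 7,
      (lead_coef (square_eq1 pencil)).@[c] != 0 & (lead_coef (square_eq2 pencil)).@[c] != 0].
Proof.
have [<- <-] := pencil_special c; rewrite !coef_map /= => h1 h2.
have [s1 s2] := square_eq_size (disc0_coef_size generic).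
have sz (p : {poly {mpoly k[22]}}) : (size p <= 7)%N -> (p`_6).@[c] != 0 -> size p = 7.
  move=> sp p6; apply/eqP; rewrite eqn_leq sp /= ltnNge; apply: contra p6 => sp6.
  by rewrite nth_default // meval0.
move: (square_eq1 pencil) (square_eq2 pencil) s1 s2 h1 h2 => p1 p2 s1 s2 h1 h2.
have e1 := sz p1 s1 h1; have e2 := sz p2 s2 h2.
by split; rewrite // lead_coefE ?e1 ?e2.
Qed.

(** A nonzero constant in the ideal of the two specialized polynomials makes them coprime. *)
Lemma square_resultant_neq0 c (C L L' : k) :
  (square_eq1 (special c))`_6 != 0 -> (square_eq2 (special c))`_6 != 0 ->
  C != 0 -> L *: square_eq2 (special c) + L' *: square_eq1 (special c) = C%:P ->
  square_resultant.@[c] != 0.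
Proof.
move=> h1 h2 C0 hC; have [_ _ l1 l2] := lead_meval h1 h2.
rewrite /square_resultant (rmorph_resultant (f := meval c)) //.
have [-> ->] := pencil_special c.
rewrite resultant_eq0 -leqNgt.
have: gcdp (square_eq1 (special c)) (square_eq2 (special c)) %| C%:P.
  by rewrite -hC -!mul_polyC dvdp_add // dvdp_mull ?dvdp_gcdl ?dvdp_gcdr.
by move/dvdp_leq; rewrite polyC_eq0 size_polyC C0 => /(_ isT).
Qed.

(** The resultant lies in the ideal of the two polynomials, so it vanishes at a common zero even if
    degrees drop at [c]. The member [c1] certifies that the generic polynomials are not constant. *)
Lemma square_resultant_eq0 c1 c u :
  (square_eq1 (special c1))`_6 != 0 -> (square_eq2 (special c1))`_6 != 0 ->
  square_eq1 (disc0_coef (coef c) u) = 0 -> square_eq2 (disc0_coef (coef c) u) = 0 ->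
  square_resultant.@[c] = 0.
Proof.
move=> h1 h2; have [s1 s2 _ _] := lead_meval h1 h2.
have [|| [a b] _ /= E] := @resultant_in_ideal _ (square_eq1 pencil) (square_eq2 pencil).
- by rewrite s1.
- by rewrite s2.
have [<- <-] := special_eval c u; have [<- <-] := pencil_special c => z1 z2.
have := congr1 (fun p => (map_poly (meval c) p).[u]) E.
rewrite /= map_polyC /= hornerC => ->.
by rewrite rmorphD !rmorphM /= hornerD !hornerM z1 z2 !mulr0 addr0.
Qed.

(* With [z = u - u0], the discriminant pencil of this conic bundle is
   4 ((t^4 + 4 M t - 3 M t0) z^2 + (t - t0)^2 (2 t + t0)). *)
Definition witness (M t0 u0 v0 : k) (i : 'I_22) : k :=
  nth 0 [:: - (3%:R * M * t0 * u0 ^+ 2) + t0 ^+ 3 - v0 ^+ 2; 4%:R * M * u0 ^+ 2;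
            - (3%:R * t0); 2%:R; u0 ^+ 2;
            6%:R * M * t0 * u0; - (8%:R * M * u0); 0; 0; - (2%:R * u0);
            2%:R * v0; 0; 0;
            - (3%:R * M * t0); 4%:R * M; 0; 0; 1;
            0; 0; 0; -1] i.

Variables (M t0 u0 v0 : k).
Let w := witness M t0 u0 v0.

Let wE :
  ((coef w 0 = - (3%:R * M * t0 * u0 ^+ 2) + t0 ^+ 3 - v0 ^+ 2)%R *
   (coef w 1 = 4%:R * M * u0 ^+ 2)%R * (coef w 2 = - (3%:R * t0))%R *
   (coef w 3 = 2%:R)%R * (coef w 4 = u0 ^+ 2)%R *
   (coef w 5 = 6%:R * M * t0 * u0)%R * (coef w 6 = - (8%:R * M * u0))%R *
   (coef w 7 = 0)%R * (coef w 8 = 0)%R * (coef w 9 = - (2%:R * u0))%R *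
   (coef w 10 = 2%:R * v0)%R * (coef w 11 = 0)%R * (coef w 12 = 0)%R *
   (coef w 13 = - (3%:R * M * t0))%R * (coef w 14 = 4%:R * M)%R *
   (coef w 15 = 0)%R * (coef w 16 = 0)%R * (coef w 17 = 1)%R *
   (coef w 18 = 0)%R * (coef w 19 = 0)%R * (coef w 20 = 0)%R *
   (coef w 21 = -1)%R)%type.
Proof. by do !split; rewrite /coef /w /witness inordK. Qed.

(** In the chart the equation is (t^4 + 4 M t - 3 M t0) (u - u0)^2 + (t - t0)^2 (2 t + t0) - (v -
    v0)^2, of order two at the given point. Its derivative in u vanishes there as well; on the
    segment used for density a nonzero one comes from the given member. *)
Lemma witness_tangent :
  [/\ conic (coef w) t0 1 1 u0 v0 = 0, conic_dt w t0 u0 v0 = 0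
    & conic_dv w t0 u0 v0 = 0].
Proof.
rewrite /conic /conic_dt /conic_dv /quartic_dx /quadric_dx /quartic /quadric !wE.
by split; ring.
Qed.

Let z : {poly k} := 'X - u0%:P.

Let witness_special :
  [/\ special w 0 = 4%:R * (t0%:P ^+ 3 - 3%:R * M%:P * t0%:P * z ^+ 2),
      special w 1 = 16%:R * M%:P * z ^+ 2,
      special w 2 = - (12%:R * t0%:P), special w 3 = 8%:R
    & special w 4 = 4%:R * z ^+ 2].
Proof.
rewrite /special /disc0_coef /z /=; split.
- by rewrite !wE; ring.
- by rewrite !wE; ring.
- by rewrite !wE; ring.
- by rewrite !wE; ring.
by rewrite !wE; ring.
Qed.

Let coef6 (a b d : k) : (a *: z ^+ 6 + b *: z ^+ 2 + d%:P)`_6 = a.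
Proof.
have z6 : (z ^+ 6)`_6 = 1.
  have /monicP := monic_exp 6 (monicXsubC u0).
  by rewrite /lead_coef size_exp_XsubC.
have z2 : (z ^+ 2)`_6 = 0 by rewrite nth_default // size_exp_XsubC.
by rewrite !coefD !coefZ z6 z2 coefC /= mulr1 mulr0 !addr0.
Qed.

Let witness_eq1 : square_eq1 (special w)
  = (1024%:R * M ^+ 2) *: z ^+ 6 + (768%:R * M * t0) *: z ^+ 2 + (- (256%:R * t0 ^+ 3))%:P.
Proof.
have [w0 w1 w2 w3 w4] := witness_special.
by rewrite /square_eq1 w0 w1 w3 w4 -!mul_polyC; ring.
Qed.

Let witness_eq2 : square_eq2 (special w)
  = (2048%:R * M) *: z ^+ 6 + (1536%:R * t0) *: z ^+ 2 + 512%:R%:P.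
Proof.
have [w0 w1 w2 w3 w4] := witness_special.
by rewrite /square_eq2 w1 w2 w3 w4 -!mul_polyC; ring.
Qed.

Hypotheses (char2 : (2%:R : k) != 0) (M0 : M != 0).

(** Both leading coefficients are a power of 2 times a power of [M], so only characteristic 2 is
    excluded. *)
Lemma witness_lead : (square_eq1 (special w))`_6 != 0 /\ (square_eq2 (special w))`_6 != 0.
Proof.
rewrite witness_eq1 witness_eq2 !coef6; split; rewrite mulf_neq0 ?expf_neq0 //.
  by rewrite (natrX k 2 10) expf_neq0.
by rewrite (natrX k 2 11) expf_neq0.
Qed.

(** The term - 3 M t0 of the witness makes the z^2 terms proportional to the z^6 terms, so that one
    combination of the two cubics is the constant 512 (M + t0^3). *)
Lemma witness_resultant : M != - t0 ^+ 3 -> square_resultant.@[w] != 0.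
Proof.
move=> Mt; have [h1 h2] := witness_lead.
apply: (@square_resultant_neq0 w (512%:R * (M + t0 ^+ 3)) M (- 2%:R)) => //.
  rewrite mulf_neq0 //; first by rewrite (natrX k 2 9) expf_neq0.
  by rewrite addr_eq0.
by rewrite witness_eq1 witness_eq2 -!mul_polyC; ring.
Qed.

Lemma square_resultantP c u :
  square_eq1 (disc0_coef (coef c) u) = 0 -> square_eq2 (disc0_coef (coef c) u) = 0 ->
  square_resultant.@[c] = 0.
Proof. by have [h1 h2] := witness_lead; apply: square_resultant_eq0 h1 h2. Qed.

Lemma witness_coef : coef w 17 = 1 /\ coef w 21 = -1.
Proof. by rewrite !wE. Qed.

End Resultant.

(** * The open condition and its density *)

Section General.
Variables (k : fieldType) (k_infinite : infinite_field k) (k_C1 : C1_field k).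
Hypothesis char2 : (2%:R : k) != 0.

Let h : {mpoly k[22]} := 'X_(inord 21) * square_resultant k.

Lemma resultant_unirational c : h.@[c] != 0 -> X6_with_tangency c -> unirational c.
Proof.
rewrite mevalM mevalXU mulf_eq0 negb_or => /andP[f0 r0].
move=> /(tangency_of_X6 k_infinite) [_ [t [u [v T]]]].
apply: (tangency_unirational k_infinite k_C1 char2 f0 T).
apply: contra r0 => /eqP rd; have [d0 d1 _] := tangency_disc char2 f0 T.
have [E1 E2] := square_eq_residual d0 d1 rd.
(* The witness with M = 1 at the origin serves to fix the generic degrees. *)
apply/eqP; apply: (@square_resultantP k 1 0 0 0 char2 (oner_neq0 k) c u) => //.
Qed.

Let segment (c w : 'I_22 -> k) (x : k) (i : 'I_22) : k := c i + x * (w i - c i).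

Let segment0 c w : segment c w 0 =1 c.
Proof. by move=> i; rewrite /segment mul0r addr0. Qed.

Let segment1 c w : segment c w 1 =1 w.
Proof. by move=> i; rewrite /segment mul1r addrC subrK. Qed.

Let segmentE c w x i : coef (segment c w x) i = coef c i + x * (coef w i - coef c i).
Proof. by []. Qed.

Let meval_segment (F : {mpoly k[22]}) c w :
  exists q : {poly k}, forall x, q.[x] = F.@[segment c w x].
Proof.
have [q qE] := meval_horner F (fun i => (c i)%:P + 'X * (w i - c i)%:P).
exists q => x; rewrite qE; apply: meval_eq => i.
by rewrite /segment !hornerE.
Qed.

(** At a fixed (t, u, v) the three equations are linear in the coefficients; the derivative in u is
    the one condition that can fail on the segment. *)
Let segment_tangent c w t u v x : tangency c t u v ->
  [/\ conic (coef w) t 1 1 u v = 0, conic_dt w t u v = 0 & conic_dv w t u v = 0] ->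
  (1 - x) * conic_du c t u v + x * conic_du w t u v != 0 ->
  tangency (segment c w x) t u v.
Proof.
move=> [c0 ct cv _] [w0 wt wv] du; split.
- transitivity ((1 - x) * conic (coef c) t 1 1 u v + x * conic (coef w) t 1 1 u v).
    by rewrite /conic /quartic /quadric !segmentE; ring.
  by rewrite c0 w0 !mulr0 addr0.
- transitivity ((1 - x) * conic_dt c t u v + x * conic_dt w t u v).
    by rewrite /conic_dt /quartic_dx /quadric_dx !segmentE; ring.
  by rewrite ct wt !mulr0 addr0.
- transitivity ((1 - x) * conic_dv c t u v + x * conic_dv w t u v).
    by rewrite /conic_dv /quadric !segmentE; ring.
  by rewrite cv wv !mulr0 addr0.
suff -> : conic_du (segment c w x) t u v
    = (1 - x) * conic_du c t u v + x * conic_du w t u v by [].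
by rewrite /conic_du /quartic /quadric !segmentE; ring.
Qed.

(** A polynomial that vanishes on the good members vanishes at all but finitely many points of the
    segment from [c] to the witness, hence at [c]. The exceptions are zeros of three polynomials in
    x: [q17] and [qu] are nonzero at x = 0, [qh] at x = 1. *)
Lemma tangency_density :
  zariski_dense_in (fun c => h.@[c] != 0 /\ X6_with_tangency c)
    (fun c => X6_with_tangency c).
Proof.
move=> F hF c Sc; have [D4 [t [u [v T]]]] := tangency_of_X6 k_infinite Sc.
(* M = 0 would kill the leading coefficients of the two cubics, and M = - t^3 would make them
   proportional. *)
have [M MS] := k_infinite [:: 0; - t ^+ 3].
rewrite !inE negb_or in MS; case/andP: MS => M0 Mt.
pose w := witness M t u v; have wT := witness_tangent M t u v.
have [w17 w21] := witness_coef M t u v.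
have [q qE] := meval_segment F c w; have [qh qhE] := meval_segment h c w.
pose q17 : {poly k} := (coef c 17)%:P + 'X * (coef w 17 - coef c 17)%:P.
pose qu : {poly k} := (1 - 'X) * (conic_du c t u v)%:P + 'X * (conic_du w t u v)%:P.
have q170 : q17 != 0.
  apply: contra D4 => /eqP q0; have := congr1 (fun p : {poly k} => p.[0]) q0.
  by rewrite /q17 !hornerE => ->.
have qu0 : qu != 0.
  have [_ _ _ du] := T; apply: contra du => /eqP q0.
  have := congr1 (fun p : {poly k} => p.[0]) q0.
  by rewrite /qu !hornerE subr0 mul1r => ->.
have qh0 : qh != 0.
  have := @witness_resultant k M t u v char2 M0 Mt => r0.
  have : h.@[w] != 0.
    by rewrite mevalM mevalXU mulf_neq0 // -/(coef w 21) w21 oppr_eq0 oner_neq0.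
  apply: contra => /eqP q0; rewrite -(meval_eq h (segment1 c w)) -qhE q0 horner0 //.
suff : q * (q17 * qu * qh) = 0.
  move/eqP; rewrite mulf_eq0 orbC !mulf_eq0 (negPf q170) (negPf qu0) (negPf qh0) /= => /eqP q0.
  by rewrite -(meval_eq F (segment0 c w)) -qE q0 horner0.
apply: (poly_eq0_eval k_infinite) => x; rewrite hornerM.
case: (eqVneq (q17 * qu * qh).[x] 0) => [->|]; first by rewrite mulr0.
rewrite !hornerM !mulf_eq0 !negb_or => /andP[/andP[x17 xu] xh].
rewrite qE hF ?mul0r //; split; first by rewrite -qhE.
apply: (@X6_of_tangency k k_infinite _ t u v).
  by move: x17; rewrite /q17 !hornerE segmentE.
apply: segment_tangent T wT _.
by move: xu; rewrite /qu !hornerE.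
Qed.

End General.

Theorem proposition4p2 (k : fieldType) (k_infinite : infinite_field k)
    (k_C1 : C1_field k) (k_char : 2%N \notin [pchar k]) :
  holds_for_general (fun c : 'I_22 -> k => X6_with_tangency c)
                    (fun c : 'I_22 -> k => unirational c).
Proof.
have char2 : (2%:R : k) != 0 by apply: contra k_char => h2; rewrite inE /=.
pose h := 'X_(inord 21) * square_resultant k.
exists (fun c => h.@[c] != 0); split.
- exists (fun F => F = h) => c; split=> [hc|[F -> //]].
  by exists h.
- exact: tangency_density.
by move=> c; exact: resultant_unirational.
Qed.
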